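(* Assume (A3), (A4), let $p=2$, $q\in(0,1)$, $\beta\ge q(1-q)$, and let $x$ be a bounded trajectory solution of (MTRIGS) with initial data $(x_0,v_0)$. Then for every $r\in[q,\frac{1+q}2]$, $$\int_{t_0}^{+\infty}s^{2r-q}\|\dot x(s)\|^2\,ds<+\infty .$$
   Context: $\mathcal H$ real Hilbert space; $f_1,\dots,f_m:\mathcal H\to\mathbb R$ convex, continuously differentiable with Lipschitz continuous gradients; $F=(f_1,\dots,f_m)^\top$. Weak Pareto optimal: no $x$ with $f_i(x)<f_i(x^* )$ for all $i$; $\mathcal P_w$ the set of such points. $\mathcal L(F,b):=\{x:f_i(x)\le b_i\ \forall i\}$, $\mathcal{LP}_w(F,b):=\mathcal L(F,b)\cap\mathcal P_w$. Parameters $t_0>0$, $\alpha,\beta>0$, $q\in(0,1]$, $p\in(0,2]$, initial data $x_0,v_0\in\mathcal H$; $C(x):=\operatorname{conv}\{\nabla f_i(x)\}$. A trajectory solution of (MTRIGS) is $x:[t_0,\infty)\to\mathcal H$, continuously differentiable, with $\dot x$ absolutely continuous on each $[t_0,T]$ and a.e. derivative $\ddot x$ (Bochner measurable, $\dot x(t)=\dot x(t_0)+\int_{t_0}^t\ddot x$), satisfying $\frac{\alpha}{t^q}\dot x(t)+\operatorname{proj}_{C(x(t))+\frac{\beta}{t^p}x(t)+\ddot x(t)}(0)=0$ for a.e. $t\ge t_0$, $x(t_0)=x_0$, $\dot x(t_0)=v_0$. (A3): with $a_i:=\frac{\beta}{2t_0^p}\|x_0\|^2+\frac12\|v_0\|^2$,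 for every $x\in\mathcal L(F,F(x_0)+a)$, $\mathcal{LP}_w(F,F(x))\ne\emptyset$, and $R:=\sup_{F^*\in F(\mathcal{LP}_w(F,F(x_0)+a))}\inf_{z\in F^{-1}(\{F^*\})}\|z\|<\infty$. (A4): $S(w):=\operatorname{argmin}_z\max_i(f_i(z)-w_i)\neq\emptyset$ for all $w\in\mathbb R^m$ and $w\mapsto\operatorname{proj}_{S(w)}(0)$ is continuous. *)

(* Defs.v *)
(* R : realType, H : complete normed space with an
   inner product inducing its norm (= real Hilbert space). *)
From HB Require Import structures.
From mathcomp Require Import all_boot all_order all_algebra.
From mathcomp Require Import all_classical all_reals all_analysis.
Set Implicit Arguments. Unset Strict Implicit. Unset Printing Implicit Defensive.
Import Order.TTheory GRing.Theory Num.Theory.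
Import numFieldNormedType.Exports.
Local Open Scope classical_set_scope.
Local Open Scope ring_scope.

Record inner_product (R : realType) (H : normedModType R) := InnerProduct {
  ip : H -> H -> R;
  ip_sym : forall x y, ip x y = ip y x;
  ip_linl : forall (a : R) (x y z : H), ip (a *: x + y) z = a * ip x z + ip y z;
  ip_norm : forall x, ip x x = `|x| ^+ 2 }.

Section Defs.
Variables (R : realType) (H : normedModType R).

Definition convex_fun (f : H -> R) : Prop :=
  forall (x y : H) (l : R), 0 <= l <= 1 ->
    f (l *: x + (1 - l) *: y) <= l * f x + (1 - l) * f y.

Definition is_gradient (ipH : inner_product H) (f : H -> R) (g : H -> H) : Prop :=
  forall x : H, forall e : R, 0 < e -> exists2 d : R, 0 < d &
    forall h : H, `|h| < d -> `|f (x + h) - f x - ip ipH (g x) h| <= e * `|h|.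

Definition lipschitz_map (g : H -> H) : Prop :=
  exists L : R, forall x y, `|g x - g y| <= L * `|x - y|.

Definition deriv_from (t0 : R) (u : R -> H) (y : H) (t : R) : Prop :=
  forall e : R, 0 < e -> exists2 d : R, 0 < d &
    forall s : R, t0 <= s -> `|s - t| < d -> `|u s - u t - (s - t) *: y| <= e * `|s - t|.

Definition abs_cont_on (a b : R) (u : R -> H) : Prop :=
  forall e : R, 0 < e -> exists2 d : R, 0 < d &
    forall (n : nat) (lo hi : 'I_n -> R),
      (forall k, a <= lo k /\ lo k <= hi k /\ hi k <= b) ->
      (forall k l, k != l -> hi k <= lo l \/ hi l <= lo k) ->
      \sum_(k < n) (hi k - lo k) < d ->
      \sum_(k < n) `|u (hi k) - u (lo k)| < e.

Definition is_proj (K : set H) (y z : H) : Prop :=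
  K z /\ forall w, K w -> `|z - y| <= `|w - y|.

Definition conv_hull (m : nat) (g : 'I_m -> H) : set H :=
  [set y | exists l : 'I_m -> R, (forall i, 0 <= l i) /\ \sum_(i < m) l i = 1 /\
      y = \sum_(i < m) l i *: g i].

Definition level_set (m : nat) (F : 'I_m -> H -> R) (b : 'I_m -> R) : set H :=
  [set x | forall i, F i x <= b i].

Definition weak_pareto (m : nat) (F : 'I_m -> H -> R) : set H :=
  [set xs | ~ exists x, forall i, F i x < F i xs].

Definition LPw (m : nat) (F : 'I_m -> H -> R) (b : 'I_m -> R) : set H :=
  level_set F b `&` weak_pareto F.

Definition Fvec (m : nat) (F : 'I_m -> H -> R) (x : H) : 'I_m -> R := fun i => F i x.

Definition assumption_A3 (m : nat) (F : 'I_m -> H -> R) (t0 beta p : R) (x0 v0 : H) : Prop :=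
  let a : 'I_m -> R := fun _ => beta / (2 * t0 `^ p) * `|x0| ^+ 2 + 2^-1 * `|v0| ^+ 2 in
  let b0 : 'I_m -> R := fun i => F i x0 + a i in
  (forall x, level_set F b0 x -> LPw F (Fvec F x) !=set0) /\
  (ereal_sup [set ereal_inf [set (`|z|)%:E | z in [set z | Fvec F z = Fs]]
              | Fs in Fvec F @` LPw F b0] < +oo)%E.

Definition maxshift (m : nat) (F : 'I_m -> H -> R) (w : 'I_m -> R) (z : H) : \bar R :=
  \big[Order.max/-oo%E]_(i < m) ((F i z - w i)%:E).

Definition Sargmin (m : nat) (F : 'I_m -> H -> R) (w : 'I_m -> R) : set H :=
  [set z | forall y, (maxshift F w z <= maxshift F w y)%E].

(* Assumption (A4); continuity of P on R^m (sup-norm, equivalent to any norm) *)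
Definition assumption_A4 (m : nat) (F : 'I_m -> H -> R) : Prop :=
  (forall w, Sargmin F w !=set0) /\
  exists P : ('I_m -> R) -> H,
    (forall (w : 'I_m -> R) (e : R), 0 < e -> exists2 d : R, 0 < d &
       forall w' : 'I_m -> R, (forall i, `|w' i - w i| < d) -> `|P w' - P w| < e) /\ forall w, is_proj (Sargmin F w) 0 (P w).

Definition MTRIGS_solution (ipH : inner_product H) (m : nat) (gradF : 'I_m -> H -> H)
    (t0 alpha beta q p : R) (x0 v0 : H) (x xd xdd : R -> H) : Prop :=
  (forall t, t0 <= t -> deriv_from t0 x (xd t) t) /\
      {within `[t0, +oo[, continuous xd} /\
      (forall T, t0 <= T -> abs_cont_on t0 T xd) /\
      {ae lebesgue_measure, forall t, t0 <= t -> deriv_from t0 xd (xdd t) t} /\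
      {ae lebesgue_measure, forall t, t0 <= t ->
          exists z, is_proj [set c + (beta / t `^ p) *: x t + xdd t
                              | c in conv_hull (fun i => gradF i (x t))] 0 z
                    /\ (alpha / t `^ q) *: xd t + z = 0} /\
  x t0 = x0 /\ xd t0 = v0.

End Defs.

(* Main.v *)
Require Import Defs.
From HB Require Import structures.
From mathcomp Require Import all_boot all_order all_algebra.
From mathcomp Require Import all_classical all_reals all_analysis.
From mathcomp Require Import measurable_realfun ring lra.
Import Order.TTheory GRing.Theory Num.Theory.
Import numFieldNormedType.Exports.
Local Open Scope classical_set_scope.
Local Open Scope ring_scope.

(** Write [h = |x - z|^2 / 2] and [W i = F i (x t) + beta / (2 t^2) |x|^2 + |xd|^2 / 2].
    Testing the projection against [gradF i] shows that every [W i] decreases at rate at least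
    [alpha t^-q |xd|^2]; since the trajectory is bounded, [W i] is bounded below, so the tail
    [rho t = alpha * int_t^oo s^-q |xd s|^2 ds] is finite and [W i t >= inf (W i) + rho t].
    (A4) with [w i = inf (W i)] provides [z] with [F i z <= inf (W i)] for all [i], whence
    [W i - F i z >= rho].  Convexity then gives
    [h'' + alpha t^-q h' <= 3/2 |xd|^2 - rho + C / t^2] with [|xd|^2 = - t^q rho' / alpha].
    Multiplying by [t^q] and integrating, [t^q h' <= C - (1/2) int s^q rho ds].  If the last
    integral diverged, then eventually [h' <= - t^-q] and, as [q < 1], [h] would tend to
    [-oo]; hence it converges, and an integration by parts bounds [int s |xd s|^2 ds], which
    is the case [r = (1 + q) / 2] and dominates all the others. *)

(** * Monotonicity from an almost everywhere derivative bound *)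

(** Let [S] collect the points of [[a, b]] where [P] holds. The step at [sup S] carries [P] from a
    point of [S] close to the supremum to [Num.min b (sup S + d / 2)], which would exceed [sup S]
    unless [sup S = b]. *)
Lemma interval_induction (R : realType) (a b : R) (P : R -> Prop) :
  a <= b -> P a ->
  (forall s, a <= s <= b -> exists2 d, 0 < d & forall t t', a <= t <= s ->
     s <= t' <= b -> s - t < d -> t' - s < d -> P t -> P t') -> P b.
Proof.
move=> ab Pa step; pose S := [set t | a <= t <= b /\ P t].
have Sa : S a by split; rewrite ?lexx.
have Sub : has_sup S by split; [exists a | exists b => t [/andP[]]].
have sab : a <= sup S <= b.
  by rewrite (ub_le_sup Sub.2 Sa) ge_sup//; [exists a | move=> t [/andP[]]].
have [d d0 Hd] := step _ sab.
have [t [/andP[ta tb] Pt] dt] := sup_adherent d0 Sub.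
have ts : t <= sup S by apply: (ub_le_sup Sub.2); split => //; rewrite ta tb.
move: sab => /andP[as_ sb].
have P' : P (Num.min b (sup S + d / 2)).
  apply: (Hd t) => //; first by rewrite ta ts.
  - by rewrite le_min sb ge_min lexx /= lerDl divr_ge0 ?ltW.
  - lra.
  - by rewrite ltrBlDr gt_min; apply/orP; right; lra.
have : Num.min b (sup S + d / 2) <= sup S.
  apply: (ub_le_sup Sub.2); split => //.
  by rewrite ge_min lexx /= le_min ab /=; lra.
rewrite ge_min => /orP[bs|]; last by move=> H; exfalso; lra.
have bE : b = sup S by apply/eqP; rewrite eq_le bs sb.
suff <- : Num.min b (sup S + d / 2) = b by [].
by apply/min_idPl; rewrite -bE; lra.
Qed.

(* Cover the null set [N] by an open set [U] of small measure.  Interval induction builds a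
   fine partition whose pieces are either controlled by the slope at a point outside [N], or
   contained in [U], where absolute continuity of [u] bounds the total increment. *)
Lemma ac_nonincreasing (R : realType) (H : normedModType R) (u : R -> H)
    (g : R -> R) (a b C : R) (N : set R) :
  a <= b -> abs_cont_on a b u -> 0 <= C ->
  (forall s t, a <= s <= b -> a <= t <= b ->
     `|g s - g t| <= C * (`|u s - u t| + `|s - t|)) ->
  (@lebesgue_measure R).-negligible N ->
  (forall t, a <= t <= b -> ~ N t -> forall e, 0 < e -> exists2 d, 0 < d &
     forall s, `|s - t| < d -> (s - t) * (g s - g t) <= e * (s - t) ^+ 2) ->
  g b <= g a.
Proof.
move=> ab acu C0 gu [M [mM M0 NM]] slope.
suff key e : 0 < e -> g b - g a <= e * (b - a) + C * (e + e).
  apply/ler_addgt0Pl => e e0; rewrite -lerBlDr.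
  have k0 : 0 < b - a + C * 2 + 1 by lra.
  apply: (le_trans (key (e / (b - a + C * 2 + 1)) _)); first exact: divr_gt0.
  rewrite -[leRHS](divfK (lt0r_neq0 k0)).
  have : 0 < e / (b - a + C * 2 + 1) by exact: divr_gt0.
  move: (e / _) => f f0; nra.
move=> e0; have [d1 d10 Hd1] := acu e e0.
(* The bound [d1] serves absolute continuity; the bound [e] controls the terms [|s - t|] in the
   domination of [g]. *)
pose d := Num.min d1 e.
have d0 : 0 < d by rewrite lt_min d10 e0.
have [U [oU MU]] : exists U : set R, [/\ open U, M `<=` U &
    (lebesgue_measure (U `\` M) < d%:E)%E].
  apply: lebesgue_regularity_outer => //.
  by apply: (@le_lt_trans _ _ 0%E); rewrite ?ltry//; move: M0 => /= ->.
rewrite (_ : lebesgue_measure (U `\` M) = lebesgue_measure U); last first.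
  rewrite -[in RHS](setDUK MU) measureU//; last 2 first.
  - by apply: measurableD => //; exact: open_measurable.
  - by rewrite setDIK.
  by move: M0 => /= ->; rewrite add0e.
move=> Ud; have mU : measurable U by exact: open_measurable.
have mUI t : measurable (U `&` `[a, t]) by exact: measurableI.
(* The listed intervals are the exceptional pieces met so far. Their total length is charged to the
   part of [U] already passed, and off them [g] grows with slope at most [e]. *)
pose P t := exists (n : nat) (lo hi : nat -> R),
  [/\ forall k, (k < n)%N -> a <= lo k /\ lo k <= hi k /\ hi k <= t,
      forall k l, (k < l < n)%N -> hi k <= lo l,
      ((\sum_(k < n) (hi k - lo k))%:E <= lebesgue_measure (U `&` `[a, t]))%E &
      g t - g a <= e * (t - a) + \sum_(k < n) `|g (hi k) - g (lo k)| ].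
have Pb : P b.
  apply: (@interval_induction _ a) => //.
    exists 0%N, (fun=> 0), (fun=> 0); split.
    - by [].
    - by move=> k l; rewrite ltn0 andbF.
    - by rewrite big_ord0.
    - by rewrite big_ord0; lra.
  move=> s sab; have [Ns|Ns] := pselect (N s).
    (* Here [s] lies in [N]: a ball around [s] sits inside [U], so [[t, t']] is appended to the list
       and its length is paid for by the measure of [U] on []t, t']]. *)
    have [r /= r0 rU] : exists2 r, 0 < r & ball s r `<=` U.
      have /(oU) : U s by exact/MU/NM.
      by rewrite /interior => /nbhs_ballP[r /= r0 ?]; exists r.
    exists r => // t t' /andP[at_ ts] /andP[st' t'b] tr t'r [n [lo [hi [lohi disj len gt]]]].
    exists n.+1, (fun k => if (k < n)%N then lo k else t), (fun k => if (k < n)%N then hi k else t').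
    have tt' : t <= t' by exact: le_trans st'.
    split.
    + move=> k; rewrite ltnS leq_eqVlt => /predU1P[->|kn]; rewrite ?ltnn//.
      rewrite kn; have [? [? ht]] := lohi _ kn; split => //; split => //.
      exact: le_trans tt'.
    + move=> k l /andP[kl]; rewrite ltnS leq_eqVlt => /predU1P[ln|ln].
        by rewrite -ln ltnn kl; have [_ []] := lohi k (leq_trans kl (eq_leq ln)).
      by rewrite ln (ltn_trans kl ln); apply: disj; rewrite kl.
    + rewrite big_ord_recr /= ltnn.
      rewrite (eq_bigr (fun k : 'I_n => hi k - lo k)); last by move=> k _; rewrite ltn_ord.
      rewrite EFinD; apply: (@le_trans _ _ (lebesgue_measure (U `&` `[a, t]) +
        lebesgue_measure `]t, t'])%E).
        apply: leeD => //; rewrite lebesgue_measure_itv /= lte_fin.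
        by have [_|t't] := ltP t t'; rewrite ?EFinB// lee_fin subr_le0.
      rewrite -measureU//; last first.
      - rewrite -subset0 => z [[_ /=]]; rewrite !in_itv /= => /andP[_ zt] /andP[tz _].
        by have := lt_le_trans tz zt; rewrite ltxx.
      - exact: mUI.
      apply: le_measure; rewrite ?inE; [by apply: measurableU => //; exact: mUI|exact: mUI|].
      move=> z [[Uz]|]; rewrite /= in_itv /=.
        by move=> /andP[az zt]; split => //=; rewrite in_itv /= az (le_trans zt).
      move=> /andP[tz zt']; split => /=; last by rewrite in_itv /= zt' (le_trans at_)// ltW.
      apply: rU; rewrite /ball /= ltr_distlC; apply/andP; split; lra.
    + rewrite big_ord_recr /= ltnn.
      rewrite (eq_bigr (fun k : 'I_n => `|g (hi k) - g (lo k)|)); last by move=> k _; rewrite ltn_ord.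
      have := ler_norm (g t' - g t).
      have : 0 <= e * (t' - t) by apply: mulr_ge0; [exact: ltW|rewrite subr_ge0].
      by move: gt; lra.
  (* Here [s] lies outside [N]: the list is unchanged, and the slope bound at [s] is used on
     [[t, s]] and on [[s, t']]. *)
  have [r r0 Hr] := slope s sab Ns e e0.
  exists r => // t t' /andP[at_ ts] /andP[st' t'b] tr t'r [n [lo [hi [lohi disj len gt]]]].
  have tt' : t <= t' by exact: le_trans st'.
  exists n, lo, hi; split => //.
  + move=> k kn; have [? [? ht]] := lohi _ kn; split => //; split => //.
    exact: le_trans tt'.
  + apply: (le_trans len); apply: le_measure; rewrite ?inE; [exact: mUI|exact: mUI|].
    move=> z [Uz]; rewrite /= in_itv /= => /andP[az zt]; split => //=; rewrite ?in_itv /= az (le_trans zt)//.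
  + have h1 : g s - g t <= e * (s - t).
      have [->|] := eqVneq t s; first by rewrite !subrr mulr0.
      rewrite neq_lt => /orP[ts'|]; last by rewrite ltNge ts.
      have /Hr : `|t - s| < r by rewrite distrC ger0_norm ?subr_ge0.
      have st0 : 0 < s - t by rewrite subr_gt0.
      by move=> h; rewrite -(ler_pM2l st0); move: h; lra.
    have h2 : g t' - g s <= e * (t' - s).
      have [->|] := eqVneq t' s; first by rewrite !subrr mulr0.
      rewrite neq_lt => /orP[|ts']; first by rewrite ltNge st'.
      have /Hr : `|t' - s| < r by rewrite ger0_norm ?subr_ge0.
      have st0 : 0 < t' - s by rewrite subr_gt0.
      by move=> h; rewrite -(ler_pM2l st0); move: h; lra.
    by move: gt h1 h2; lra.
have [n [lo [hi [lohi disj len gt]]]] := Pb.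
apply: (le_trans gt); rewrite lerD2l.
have lend : \sum_(k < n) (hi k - lo k) < d.
  rewrite -lte_fin; apply: le_lt_trans Ud; apply: (le_trans len).
  by apply: le_measure; rewrite ?inE; [exact: mUI|exact: mU|exact: subIsetl].
have acs : \sum_(k < n) `|u (hi k) - u (lo k)| < e.
  apply: (Hd1 n (fun k => lo k) (fun k => hi k)).
  - by move=> k; exact: lohi.
  - move=> k l; rewrite neq_ltn => /orP[] kl; [left|right];
    by apply: disj; rewrite kl /=.
  - by apply: (lt_le_trans lend); rewrite ge_min lexx.
apply: (@le_trans _ _ (C * (\sum_(k < n) `|u (hi k) - u (lo k)| + \sum_(k < n) (hi k - lo k)))).
  rewrite -big_split /= mulr_sumr; apply: ler_sum => k _.
  have [h1 [h2 h3]] := lohi k (ltn_ord k).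
  apply: (le_trans (gu _ _ _ _)); first by rewrite (le_trans h1).
    by rewrite h1 (le_trans h2).
  by rewrite (ger0_norm (x := hi k - lo k)) ?subr_ge0.
apply: ler_wpM2l => //; apply: lerD; first exact: ltW.
by apply: ltW; apply: (lt_le_trans lend); rewrite ge_min lexx orbT.
Qed.

(** * Inner products, convexity and projections *)

Section InnerProduct.
Context (R : realType) (H : normedModType R) (ipH : inner_product H).
Implicit Types (x y z : H).
Notation "'<|' x , y '|>'" := (ip ipH x y).

Lemma ipDl x y z : <| x + y, z |> = <| x, z |> + <| y, z |>.
Proof. by have := ip_linl ipH 1 x y z; rewrite scale1r mul1r. Qed.

Lemma ip0l z : <| 0, z |> = 0.
Proof. by have := ipDl 0 0 z; rewrite addr0; lra. Qed.

Lemma ipZl (a : R) x z : <| a *: x, z |> = a * <| x, z |>.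
Proof. by rewrite -[a *: x]addr0 ip_linl ip0l addr0. Qed.

Lemma ipNl x z : <| - x, z |> = - <| x, z |>.
Proof. by rewrite -scaleN1r ipZl mulN1r. Qed.

Lemma ipBl x y z : <| x - y, z |> = <| x, z |> - <| y, z |>.
Proof. by rewrite ipDl ipNl. Qed.

Lemma ip_suml n (h : 'I_n -> H) z : <| \sum_(i < n) h i, z |> = \sum_(i < n) <| h i, z |>.
Proof.
by elim/big_ind2: _ => [|u a v b <- <-|//]; rewrite ?ip0l ?ipDl.
Qed.

Lemma ipDr x y z : <| z, x + y |> = <| z, x |> + <| z, y |>.
Proof. by rewrite ip_sym ipDl !(ip_sym _ z). Qed.

Lemma ipZr (a : R) x z : <| z, a *: x |> = a * <| z, x |>.
Proof. by rewrite ip_sym ipZl ip_sym. Qed.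

Lemma ipNr x z : <| z, - x |> = - <| z, x |>.
Proof. by rewrite ip_sym ipNl ip_sym. Qed.

Lemma ipBr x y z : <| z, x - y |> = <| z, x |> - <| z, y |>.
Proof. by rewrite ipDr ipNr. Qed.

Lemma ip_ge0 x : 0 <= <| x, x |>.
Proof. by rewrite ip_norm exprn_ge0. Qed.

Lemma ip_CauchySchwarz x y : `|<| x, y |>| <= `|x| * `|y|.
Proof.
have [->|y0] := eqVneq y 0; first by rewrite ip_sym ip0l !normr0 mulr0.
have ny : 0 < `|y| by rewrite normr_gt0.
rewrite -ler_sqr ?nnegrE ?mulr_ge0// real_normK ?num_real// exprMn.
(* The squared norm of this vector is [|y|^2 (|x|^2 |y|^2 - <x, y>^2)]. *)
have := ip_ge0 (`|y| ^+ 2 *: x - <| x, y |> *: y).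
rewrite !(ipBl, ipBr, ipZl, ipZr) (ip_sym _ y x) !ip_norm.
have b2 : 0 < `|y| ^+ 2 by rewrite exprn_gt0.
move=> h; rewrite -subr_ge0 -(pmulr_rge0 _ b2); apply: le_trans h _.
by rewrite le_eqVlt; apply/orP; left; apply/eqP; ring.
Qed.

Lemma cvg_ip (T : Type) (F : set_system T) (FF : Filter F) (u v : T -> H) x y :
  u @ F --> x -> v @ F --> y -> <| u t, v t |> @[t --> F] --> <| x, y |>.
Proof.
move=> ux vy.
have h0 : `|u t - x| * `|v t| + `|x| * `|v t - y| @[t --> F] --> (0 : R).
  rewrite (_ : (0 : R) = `|x - x| * `|y| + `|x| * `|y - y|); last by rewrite !subrr !normr0 mulr0 mul0r addr0.
  apply: cvgD; apply: cvgM; apply: cvg_norm => //; try exact: cvg_cst.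
  - by apply: cvgB => //; exact: cvg_cst.
  - by apply: cvgB => //; exact: cvg_cst.
apply/cvgrPdist_le => e e0.
move/cvgr0_norm_le : h0 => /(_ e e0); apply: filterS => t.
apply: le_trans; rewrite distrC.
have -> : <| u t, v t |> - <| x, y |> = <| u t - x, v t |> + <| x, v t - y |>.
  by rewrite ipBl ipBr; ring.
apply: (le_trans (ler_normD _ _)); rewrite [leRHS]ger0_norm; last first.
  by rewrite addr_ge0 // mulr_ge0.
by apply: lerD; exact: ip_CauchySchwarz.
Qed.

Lemma norm2E x : `|x| ^+ 2 = <| x, x |>. Proof. by rewrite ip_norm. Qed.

(** Convexity bounds the increment of [f] along [l *: (y - x)] by [l (f y - f x)], while the
    gradient computes it up to [e * l]. Dividing by [l] leaves an arbitrary error [e]. *)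
Lemma convex_gradient_le (f : H -> R) (g : H -> H) x y :
  convex_fun f -> is_gradient ipH f g -> f x + <| g x, y - x |> <= f y.
Proof.
move=> cf gf; apply/ler_addgt0Pl => e e0.
pose n := `|y - x| + 1; have n0 : 0 < n by rewrite ltr_pwDr.
have [d d0 Hd] := gf x (e / n) (divr_gt0 e0 n0).
(* Small enough that [l * |y - x| < d]; taking [n = |y - x| + 1] covers the case [y = x]. *)
pose l := Num.min 1 (d / (n * 2)).
have l0 : 0 < l by rewrite lt_min ltr01 divr_gt0 // mulr_gt0.
have l1 : l <= 1 by rewrite ge_min lexx.
have ld : l * n < d.
  apply: (@le_lt_trans _ _ (d / (n * 2) * n)); first by rewrite ler_pM2r// ge_min lexx orbT.
  have -> : d / (n * 2) * n = d / 2 by field; rewrite gt_eqF.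
  by lra.
have /Hd : `|l *: (y - x)| < d.
  by rewrite normrZ gtr0_norm//; apply: le_lt_trans ld; rewrite ler_pM2l// lerDl.
have := cf y x l; rewrite (ltW l0) l1 => /(_ isT).
have -> : l *: y + (1 - l) *: x = x + l *: (y - x).
  by rewrite scalerBl scale1r scalerBr addrC -addrA [- _ + _]addrC.
move=> h1; rewrite ler_norml => /andP[h2 _]; move: h2.
rewrite ipZr normrZ gtr0_norm// => h2.
rewrite -(ler_pM2l l0).
have h3 : e / n * (l * `|y - x|) <= e * l.
  have -> : e / n * (l * `|y - x|) = e * l * (`|y - x| / n) by ring.
  by rewrite ger_pMr ?mulr_gt0// ler_pdivrMr// mul1r lerDl.
by lra.
Qed.

(** Minimality of [z] against [z + l *: (w - z)] gives [0 <= 2 l <w - z, z> + l^2 |w - z|^2]; divide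
    by [l] and let [l] be small. *)
Lemma is_proj_variational (K : set H) z w : (forall a b, K a -> K b -> forall l, 0 <= l <= 1 ->
    K (a + l *: (b - a))) -> is_proj K 0 z -> K w -> `|z| ^+ 2 <= <| w, z |>.
Proof.
move=> cK [Kz zmin] Kw; apply/ler_addgt0Pl => e e0.
pose n := `|w - z| ^+ 2 + 1; have n0 : 0 < n by rewrite ltr_pwDr// exprn_ge0.
pose l := Num.min 1 (e / n).
have l0 : 0 < l by rewrite lt_min ltr01 divr_gt0.
have l1 : l <= 1 by rewrite ge_min lexx.
have ln : l * n <= e.
  by rewrite -ler_pdivlMr// ge_min lexx orbT.
have /zmin : K (z + l *: (w - z)) by apply: cK => //; rewrite ltW.
have wE : <| w, z |> = <| w - z, z |> + <| z, z |> by rewrite ipBl subrK.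
rewrite !subr0 -ler_sqr ?nnegrE// wE; move: (w - z) @n n0 @l l0 l1 ln => v n n0 l l0 l1 ln.
rewrite !norm2E !(ipDl, ipDr, ipZl, ipZr) (ip_sym _ z v) -(norm2E v) => h.
have : l * (<| z, z |>) <= l * (e + (<| v, z |> + <| z, z |>)).
  have : l * (l * `|v| ^+ 2) <= l * e.
    by rewrite ler_pM2l//; apply: le_trans ln; rewrite ler_pM2l// lerDl.
  have : 0 <= l * e by rewrite mulr_ge0 ?ltW.
  by move: h; lra.
by rewrite ler_pM2l// addrC.
Qed.

End InnerProduct.

(** * Derivatives *)

Section Derivatives.
Context (R : realType).

Lemma is_derive1P (W : normedModType R) (f : R -> W) (t : R) (d : W) :
  is_derive t 1 f d <-> h^-1 *: (f (h + t) - f t) @[h --> 0^'] --> d.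
Proof.
have E : (fun h : R => h^-1 *: (f (h + t) - f t)) =
    (fun h => h^-1 *: ((f \o shift t) (h *: 1) - f t)).
  by apply/funext => h /=; rewrite /GRing.scale /= mulr1.
rewrite E; split=> [[df <-]|H] //; split; first by apply/cvg_ex; exists d.
by apply/cvg_lim.
Qed.

Lemma deriv_from_is_derive (W : normedModType R) (t0 t : R) (u : R -> W) y :
  t0 < t -> deriv_from t0 u y t -> is_derive t 1 u y.
Proof.
move=> t0t du; apply/is_derive1P/cvgrPdist_le => e e0.
have [d d0 Hd] := du e e0.
near=> h.
have h0 : h != 0 by near: h; exact: nbhs_dnbhs_neq.
have hd : `|h| < Num.min d (t - t0).
  by near: h; apply: dnbhs0_lt; rewrite lt_min d0 subr_gt0.
move: hd; rewrite lt_min => /andP[hd ht].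
have := Hd (h + t); rewrite addrK => /(_ _ hd) H.
rewrite distrC -(scalerK h0 y) -scalerBr normrZ normfV ler_pdivrMl ?normr_gt0//.
rewrite mulrC; apply: H.
by move: ht; rewrite ltr_norml => /andP[]; lra.
Unshelve. all: by end_near. Qed.

(** Multiplying the increment by [s - t] treats both sides of [t] in a single inequality, the form
    that [ac_nonincreasing] asks for. *)
Lemma is_derive_slope_le (g : R -> R) (t c : R) : is_derive t 1 g c -> c <= 0 ->
  forall e, 0 < e -> exists2 d, 0 < d &
    forall s, `|s - t| < d -> (s - t) * (g s - g t) <= e * (s - t) ^+ 2.
Proof.
move=> /is_derive1P /cvgrPdist_le dg c0 e e0.
have [d /= d0 Hd] := dg e e0; exists d => // s st.
have [->|st0] := eqVneq s t; first by rewrite !subrr mul0r expr0n mulr0.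
have s0 : s - t != 0 by rewrite subr_eq0.
have := Hd (s - t); rewrite /ball_ /= sub0r normrN subrK => /(_ st s0).
rewrite ler_norml => /andP[h _].
have {h} h : (s - t)^-1 * (g s - g t) <= e by move: h; rewrite /GRing.scale /=; lra.
have p : 0 < (s - t) ^+ 2 by rewrite exprn_even_gt0.
rewrite -(ler_pM2r p) in h; apply: le_trans h.
by rewrite mulrAC expr2 mulKf.
Qed.

Lemma is_derive1_continuous (W : normedModType R) (f : R -> W) (t : R) (d : W) :
  is_derive t 1 f d -> {for t, continuous f}.
Proof. by move=> [df _]; apply: differentiable_continuous; exact/derivable1_diffP. Qed.

Lemma is_derive_cstf (t c : R) : is_derive t 1 (fun=> c) (0 : R).
Proof. exact: is_derive_cst. Qed.

Lemma is_derive_addf (f g : R -> R) (t a b : R) :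
  is_derive t 1 f a -> is_derive t 1 g b -> is_derive t 1 (fun s => f s + g s) (a + b).
Proof. exact: is_deriveD. Qed.

Lemma is_derive_mulf (f g : R -> R) (t a b : R) :
  is_derive t 1 f a -> is_derive t 1 g b ->
  is_derive t 1 (fun s => f s * g s) (a * g t + f t * b).
Proof. by move=> df dg; apply: is_derive_eq; rewrite /GRing.scale /=; ring. Qed.

Lemma is_derive_scalef (f : R -> R) (t a c : R) :
  is_derive t 1 f a -> is_derive t 1 (fun s => c * f s) (c * a).
Proof.
move=> df; rewrite (_ : c * a = 0 * f t + c * a); last by rewrite mul0r add0r.
by apply: is_derive_mulf => //; exact: is_derive_cstf.
Qed.

Context (H : normedModType R) (ipH : inner_product H).

Lemma is_derive_ip (u v : R -> H) (t : R) y w :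
  is_derive t 1 u y -> is_derive t 1 v w ->
  is_derive t 1 (fun s => ip ipH (u s) (v s)) (ip ipH y (v t) + ip ipH (u t) w).
Proof.
move=> du dv; have cv := is_derive1_continuous _ _ _ _ dv.
move/is_derive1P : du => du; move/is_derive1P : dv => dv; apply/is_derive1P.
under eq_cvg => h.
  rewrite (_ : _ *: _ = ip ipH (h^-1 *: (u (h + t) - u t)) (v (h + t)) +
     ip ipH (u t) (h^-1 *: (v (h + t) - v t))); last first.
    by rewrite !(ipZl, ipZr, ipBl, ipBr) /GRing.scale /=; ring.
  over.
apply: cvgD; apply: cvg_ip => //; last exact: cvg_cst.
have ht : h + t @[h --> (0:R)^'] --> t.
  rewrite -[X in _ --> X]add0r; apply: cvgD; last exact: cvg_cst.
  exact: nbhs_dnbhs.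
exact: (cvg_comp _ _ ht cv).
Qed.

Lemma is_derive_gradient (f : H -> R) (g : H -> H) (x : R -> H) (t : R) y :
  is_gradient ipH f g -> is_derive t 1 x y ->
  is_derive t 1 (fun s => f (x s)) (ip ipH (g (x t)) y).
Proof.
move=> gf dx; have cx := is_derive1_continuous _ _ _ _ dx.
move/is_derive1P : dx => dx; apply/is_derive1P/cvgrPdist_le => e e0.
have ht : h + t @[h --> (0:R)^'] --> t.
  rewrite -[X in _ --> X]add0r; apply: cvgD; last exact: cvg_cst.
  exact: nbhs_dnbhs.
(* The difference quotients of [x] are eventually of norm at most [|y| + 1], so this tolerance makes
   the remainder of [f] cost at most [e / 2]. *)
have [d d0 Hd] := gf (x t) (e / 2 / (`|y| + 1)) (divr_gt0 (divr_gt0 e0 (ltr0Sn R 1)) (ltr_pwDr ltr01 (normr_ge0 _))).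
have h1 : ip ipH (g (x t)) (h^-1 *: (x (h + t) - x t)) @[h --> (0:R)^'] --> ip ipH (g (x t)) y.
  by apply: cvg_ip => //; exact: cvg_cst.
have e2 : 0 < e / 2 by rewrite divr_gt0.
near=> h.
have h0 : h != 0 by near: h; exact: nbhs_dnbhs_neq.
have k1 : `|x t - x (h + t)| < d.
  by near: h; have /cvgrPdist_lt := cvg_comp _ _ ht cx; apply.
have k2 : `|y - h^-1 *: (x (h + t) - x t)| <= 1.
  by near: h; have /cvgrPdist_le := dx; apply.
have k3 : `|ip ipH (g (x t)) y - ip ipH (g (x t)) (h^-1 *: (x (h + t) - x t))| <= e / 2.
  by near: h; have /cvgrPdist_le := h1; apply.
have := Hd (x (h + t) - x t); rewrite distrC => /(_ k1).
rewrite [x t + _]addrC subrK => k4.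
have k5 : `|h^-1 *: (x (h + t) - x t)| <= `|y| + 1.
  have := ler_normB y (y - h^-1 *: (x (h + t) - x t)); rewrite opprB addrC subrK.
  by move: k2; lra.
have k6 : `|h^-1 *: (f (x (h + t)) - f (x t)) - ip ipH (g (x t)) (h^-1 *: (x (h + t) - x t))| <= e / 2.
  rewrite ipZr -scalerBr normrZ.
  apply: (@le_trans _ _ (`|h^-1| * (e / 2 / (`|y| + 1) * `|x (h + t) - x t|))).
    by rewrite ler_wpM2l// (distrC (x (h + t))) k4.
  rewrite mulrCA -(normrZ (h^-1)).
  apply: (@le_trans _ _ (e / 2 / (`|y| + 1) * (`|y| + 1))).
    by rewrite ler_wpM2l// divr_ge0 ?addr_ge0// ltW.
  by rewrite divfK// gt_eqF// ltr_pwDr.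
have -> : e = e / 2 + e / 2 by lra.
apply: le_trans (lerD k3 k6); rewrite (distrC (h^-1 *: _)).
apply: le_trans (ler_normD _ _).
by rewrite le_eqVlt; apply/orP; left; apply/eqP; congr (`|_|); ring.
Unshelve. all: by end_near. Qed.

End Derivatives.

Lemma continuous_bounded_itv (R : realType) (W : normedModType R) (f : R -> W) (a b : R) :
  a <= b -> (forall t, a <= t <= b -> {for t, continuous f}) ->
  exists B, forall t, a <= t <= b -> `|f t| <= B.
Proof.
move=> ab cf; have := @EVT_max R (fun t => `|f t|) a b ab.
case.
  apply: continuous_in_subspaceT => t; rewrite inE /= in_itv /= => tab.
  by apply: continuous_comp; [exact: cf|exact: norm_continuous].
move=> c _ Hc; exists `|f c| => t tab; apply: Hc; by rewrite in_itv.
Qed.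

(** * Domination by the increments of a map *)

Section Dominated.
Context (R : realType) (H : normedModType R) (u : R -> H) (a b : R).

(* Absolute continuity of [u] passes to dominated functions. *)
Definition dominated (W : normedModType R) (g : R -> W) : Prop :=
  exists2 C, 0 <= C & forall s t, a <= s <= b -> a <= t <= b ->
     `|g s - g t| <= C * (`|u s - u t| + `|s - t|).

Lemma dominated_self : dominated H u.
Proof. by exists 1 => // s t _ _; rewrite mul1r lerDl. Qed.

Lemma dominated_cst (W : normedModType R) (c : W) : dominated W (fun=> c).
Proof. by exists 0 => // s t _ _; rewrite subrr normr0 mul0r. Qed.

Lemma dominatedD (W : normedModType R) (f g : R -> W) :
  dominated W f -> dominated W g -> dominated W (fun s => f s + g s).
Proof.
move=> [C C0 hC] [D D0 hD]; exists (C + D); first exact: addr_ge0.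
move=> s t sab tab; rewrite opprD addrACA mulrDl.
by apply: (le_trans (ler_normD _ _)); apply: lerD; [exact: hC|exact: hD].
Qed.

(** The mean value theorem is applied to the scalar function [<f, e>] with [e = f t - f s]. It
    yields [|e|^2 <= B |e| |t - s|], where [B] bounds [df] on [[a, b]]. *)
Lemma dominated_derive (W : normedModType R) (ipW : inner_product W) (f df : R -> W) :
  a <= b -> (forall t, a <= t <= b -> is_derive t 1 f (df t)) ->
  (forall t, a <= t <= b -> {for t, continuous df}) -> dominated W f.
Proof.
move=> ab fd cdf; have [B hB] := continuous_bounded_itv _ _ _ _ _ ab cdf.
have B0 : 0 <= B by apply: le_trans (hB a _); rewrite ?lexx.
exists B => //.
have aux s t : a <= s -> s <= t -> t <= b -> `|f t - f s| <= B * `|t - s|.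
  move=> as_ st tb.
  pose e := f t - f s.
  have dfe c : a <= c <= b -> is_derive c 1 (fun r => ip ipW (f r) e) (ip ipW (df c) e).
    move=> cab; have hf := fd c cab.
    rewrite (_ : ip ipW (df c) e = ip ipW (df c) e + ip ipW (f c) 0); last first.
      by rewrite (ip_sym _ _ 0) ip0l addr0.
    by apply: is_derive_ip => //; exact: is_derive_cst.
  have [c cst cE] : exists2 c, c \in `[s, t] &
      ip ipW (f t) e - ip ipW (f s) e = ip ipW (df c) e * (t - s).
    apply: (@MVT_segment _ (fun r => ip ipW (f r) e) (fun r => ip ipW (df r) e)) => //.
      move=> c; rewrite in_itv /= => /andP[sc ct]; apply: dfe.
      by rewrite (le_trans as_ (ltW sc)) (le_trans (ltW ct)).
    apply: continuous_in_subspaceT => c; rewrite inE /= in_itv /= => /andP[sc ct].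
    apply: (is_derive1_continuous _ _ _ _ _ (dfe c _)).
    by rewrite (le_trans as_ sc) (le_trans ct).
  move: cst; rewrite in_itv /= => /andP[sc ct].
  have cab : a <= c <= b by rewrite (le_trans as_ sc) (le_trans ct).
  have [e0|e0] := eqVneq e 0.
    by rewrite -/e e0 normr0 mulr_ge0.
  have ne : 0 < `|e| by rewrite normr_gt0.
  rewrite -/e -(ler_pM2r ne) -expr2 (norm2E _ _ ipW) {1}/e ipBl cE.
  rewrite mulrAC (ger0_norm (_ : 0 <= t - s)) ?subr_ge0//.
  apply: ler_wpM2r; first by rewrite subr_ge0.
  apply: (le_trans (ler_norm _)); apply: (le_trans (ip_CauchySchwarz _ _ _ _ _)).
  by rewrite ler_wpM2r// hB.
move=> s t /andP[as_ sb] /andP[at_ tb].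
apply: (@le_trans _ _ (B * `|s - t|)).
  have [st|/ltW ts] := leP s t; last exact: aux.
  by rewrite distrC (distrC s); exact: aux.
by rewrite ler_wpM2l// lerDr.
Qed.

Context (B : R) (ab : a <= b) (uB : forall t, a <= t <= b -> `|u t| <= B).

Lemma dominated_bounded (W : normedModType R) (g : R -> W) :
  dominated W g -> exists2 D, 0 <= D & forall t, a <= t <= b -> `|g t| <= D.
Proof.
have B0 : 0 <= B by apply: le_trans (uB a _); rewrite ?lexx.
move=> [C C0 hC]; exists (`|g a| + C * (B + B + (b - a))).
  apply: addr_ge0 => //; apply: mulr_ge0 => //; move: ab B0; lra.
move=> t tab.
have aab : a <= a <= b by rewrite lexx.
rewrite -(subrK (g a) (g t)) addrC.
apply: (le_trans (ler_normD _ _)); rewrite lerD2l; apply: (le_trans (hC _ _ tab aab)).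
apply: ler_wpM2l => //; apply: lerD.
  by apply: (le_trans (ler_normB _ _)); apply: lerD; exact: uB.
by case/andP: tab => at_ tb; rewrite ger0_norm ?subr_ge0// lerD2r.
Qed.

Lemma dominated_ip (W : normedModType R) (ipW : inner_product W) (f g : R -> W) :
  dominated W f -> dominated W g -> dominated R^o (fun s => ip ipW (f s) (g s)).
Proof.
move=> df dg; have [M M0 hM] := dominated_bounded _ _ df.
have [N N0 hN] := dominated_bounded _ _ dg.
case: df dg => [C C0 hC] [D D0 hD].
exists (C * N + M * D); first by rewrite addr_ge0 // mulr_ge0.
move=> s t sab tab.
have -> : ip ipW (f s) (g s) - ip ipW (f t) (g t) = ip ipW (f s - f t) (g s) + ip ipW (f t) (g s - g t).
  by rewrite ipBl ipBr; ring.
apply: (le_trans (ler_normD _ _)); rewrite mulrDl; apply: lerD.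
  apply: (le_trans (ip_CauchySchwarz _ _ _ _ _)); rewrite mulrAC.
  by apply: ler_pM => //; [exact: hC|exact: hN].
apply: (le_trans (ip_CauchySchwarz _ _ _ _ _)); rewrite -mulrA.
by apply: ler_pM => //; [exact: hM|exact: hD].
Qed.

End Dominated.

(* Makes the lemmas stated for an inner product also cover products of real functions. *)
Definition real_ip (R : realType) : inner_product R^o.
Proof.
exists (fun x y : R => x * y) => [x y|c x y z|x].
- by rewrite mulrC.
- by rewrite mulrDl /GRing.scale /= mulrA.
- by rewrite -expr2 real_normK ?num_real.
Defined.

(** The exceptional null set of [ac_nonincreasing] is taken to be the one off which a nonpositive
    derivative exists; domination by [u] supplies the modulus of [g]. *)
Lemma ae_nonincreasing (R : realType) (H : normedModType R) (u : R -> H)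
    (g : R -> R) (a b : R) :
  a <= b -> abs_cont_on a b u -> dominated R H u a b R^o g ->
  {ae @lebesgue_measure R, forall t, a <= t -> exists2 c, c <= 0 & is_derive t 1 g c} ->
  g b <= g a.
Proof.
move=> ab acu [C C0 hC] [N [mN N0 NN]].
apply: (@ac_nonincreasing _ _ u g a b C N) => //.
  by exists N; split.
move=> t tab nN.
have [c c0 dc] : exists2 c, c <= 0 & is_derive t 1 g c.
  apply: contrapT => h; apply: nN; apply: NN => /= h'; apply: h; apply: h'.
  by case/andP: tab.
by apply: is_derive_slope_le dc c0.
Qed.

Lemma is_derive_primitive (R : realType) (f : R -> R) (a t : R) :
  continuous f -> a < t ->
  is_derive t 1 (fun s => \int[lebesgue_measure]_(r in `[a, s]) f r)%R (f t).
Proof.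
(* The right end [t + 1] makes [t] interior to the interval of integrability. *)
move=> cf at_; have [] := @continuous_FTC1_closed R f a t (t + 1) _ _ at_ (cf t).
- by rewrite ltrDl.
- apply: continuous_compact_integrable; first exact: segment_compact.
  exact: continuous_subspaceT.
by move=> d1 d2; split => //; rewrite -derive1E.
Qed.

(** * Bounded trajectories *)

Lemma conv_hull_gen (R : realType) (H : normedModType R) (m : nat) (g : 'I_m -> H) i :
  conv_hull g (g i).
Proof.
exists (fun j => (j == i)%:R); split; first by move=> j; exact: ler0n.
split; first by rewrite (bigD1 i)//= eqxx big1 ?addr0// => j /negPf ->.
by rewrite (bigD1 i)//= eqxx scale1r big1 ?addr0// => j /negPf ->; rewrite scale0r.
Qed.

Lemma conv_hull_convex (R : realType) (H : normedModType R) (m : nat) (g : 'I_m -> H) a b l :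
  conv_hull g a -> conv_hull g b -> 0 <= l <= 1 -> conv_hull g (a + l *: (b - a)).
Proof.
move=> [la [la0 [la1 ->]]] [lb [lb0 [lb1 ->]]] /andP[l0 l1].
exists (fun i => (1 - l) * la i + l * lb i); split.
  by move=> i; rewrite addr_ge0// mulr_ge0// subr_ge0.
split; first by rewrite big_split /= -!mulr_sumr la1 lb1; ring.
rewrite [RHS](eq_bigr (fun i => (1 - l) *: (la i *: g i) + l *: (lb i *: g i))); last first.
  by move=> i _; rewrite (scalerDl _ _ (l * _)) !scalerA.
by rewrite big_split /= -!scaler_sumr scalerBl scale1r scalerBr addrA addrAC.
Qed.

(* Testing the minimal-norm property against [g i + w] gives the dissipation inequality;
   membership of the projection in the shifted hull gives the multipliers. *)
Lemma steepest_descent_eq (R : realType) (H : normedModType R) (ipH : inner_product H)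
    (m : nat) (g : 'I_m -> H) (k : R) (v w1 w2 : H) : 0 < k ->
  (exists z, is_proj [set c + w1 + w2 | c in conv_hull g] 0 z /\ k *: v + z = 0) ->
  (forall i, ip ipH (g i + w1 + w2) v <= - k * `|v| ^+ 2) /\
  exists l : 'I_m -> R, (forall i, 0 <= l i) /\ \sum_(i < m) l i = 1 /\
    w2 = - (k *: v) - w1 - \sum_(i < m) l i *: g i.
Proof.
move=> k0 [z [zproj kvz]].
have zE : z = - (k *: v) by apply/eqP; rewrite -addr_eq0 addrC kvz.
split.
  move=> i; have := is_proj_variational R H ipH _ _ (g i + w1 + w2) _ zproj.
  have K : [set c + w1 + w2 | c in conv_hull g] (g i + w1 + w2).
    by exists (g i) => //; exact: conv_hull_gen.
  move=> /(_ _ K); rewrite zE normrN normrZ gtr0_norm// exprMn ipNr ipZr => h.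
  rewrite -(ler_pM2l k0).
  have {}h : k ^+ 2 * `|v| ^+ 2 <= - (k * ip ipH (g i + w1 + w2) v).
    apply: h => _ _ [a ha <-] [b hb <-] l l01.
    exists (a + l *: (b - a)); first exact: conv_hull_convex.
    have -> : b + w1 + w2 - (a + w1 + w2) = b - a by rewrite !opprD addrACA subrr addr0 addrACA subrr addr0.
    by rewrite -!addrA; congr (a + _); rewrite addrC -addrA.
  by move: h; rewrite expr2; lra.
case: zproj => -[c [l [l0 [l1 ->]]] cz] _.
exists l; split => //; split => //.
by rewrite -zE -cz [_ - w1]addrAC addrK [_ + w2]addrC addrK.
Qed.

Section Trajectory.
Context (R : realType) (H : normedModType R) (ipH : inner_product H) (m : nat)
  (F : 'I_m -> H -> R) (gradF : 'I_m -> H -> H)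
  (t0 alpha beta q M : R) (x xd xdd : R -> H).
Hypotheses (cvxF : forall i, convex_fun (F i))
  (gradFP : forall i, is_gradient ipH (F i) (gradF i))
  (lipF : forall i, lipschitz_map (gradF i))
  (t0_gt0 : 0 < t0) (alpha_gt0 : 0 < alpha) (beta_gt0 : 0 < beta) (q01 : 0 < q < 1)
  (dx : forall t, t0 < t -> is_derive t 1 x (xd t))
  (cxd : {within `[t0, +oo[, continuous xd})
  (acxd : forall T, t0 <= T -> abs_cont_on t0 T xd)
  (dxd : {ae lebesgue_measure, forall t, t0 < t -> is_derive t 1 xd (xdd t)})
  (eqn : {ae lebesgue_measure, forall t, t0 < t ->
     (forall i, ip ipH (gradF i (x t) + (beta * t `^ (-2)) *: x t + xdd t) (xd t)
        <= - (alpha * t `^ (- q)) * `|xd t| ^+ 2) /\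
     exists l : 'I_m -> R, (forall i, 0 <= l i) /\ \sum_(i < m) l i = 1 /\
       xdd t = - ((alpha * t `^ (- q)) *: xd t) - (beta * t `^ (-2)) *: x t
               - \sum_(i < m) l i *: gradF i (x t)})
  (xM : forall t, t0 <= t -> `|x t| <= M).

Notation "'<|' u , v '|>'" := (ip ipH u v).

(* Constant extension below [t0], so that integrands are continuous on the whole line. *)
Definition extxd (t : R) : H := xd (Num.max t0 t).

Lemma extxdE t : t0 <= t -> extxd t = xd t.
Proof. by move=> tt; rewrite /extxd; congr xd; apply/max_idPr. Qed.

Lemma continuous_maxt0 : continuous (fun t : R => Num.max t0 t).
Proof.
move=> t; apply: (@continuous_max R R (fun=> t0) id); [exact: cvg_cst|exact: cvg_id].
Qed.

(** [Num.max t0] takes values in the half-line, where continuity of [xd] relative to that half-line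
    is enough. *)
Lemma continuous_extxd : continuous extxd.
Proof.
move=> t; move/subspace_continuousP : cxd => /(_ (Num.max t0 t)).
have tt : t0 <= Num.max t0 t by rewrite le_max lexx.
rewrite /= in_itv /= tt => /(_ isT) c.
apply: (cvg_comp (fun s => Num.max t0 s) xd _ c).
move=> A; rewrite /within /= => hA.
have {}hA : nbhs t (fun s => `[t0, +oo[%classic (Num.max t0 s) -> A (Num.max t0 s)) := continuous_maxt0 t _ hA.
change (nbhs t (fun s => A (Num.max t0 s))).
by apply: filterS hA => s; apply; rewrite /= in_itv /= le_max lexx.
Qed.

Lemma xd_cont t : t0 < t -> {for t, continuous xd}.
Proof.
move=> tt; have := @continuous_extxd t; rewrite /continuous_at extxdE ?ltW//.
apply: cvg_trans; apply: near_eq_cvg; near=> s; rewrite extxdE//.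
by apply: ltW; near: s; exact: lt_nbhsr.
Unshelve. all: by end_near. Qed.

Lemma powR_is_derive (t e : R) : t0 < t -> is_derive t 1 (fun s : R => s `^ e) (e * t `^ (e - 1)).
Proof. by move=> tt; apply: is_derive1_powR; exact: lt_trans tt. Qed.

Lemma powR_cont (t e : R) : t0 < t -> {for t, continuous (fun s : R => s `^ e)}.
Proof. by move=> tt; exact: (is_derive1_continuous _ _ _ _ _ (powR_is_derive t e tt)). Qed.

Lemma continuous_powR_max (e : R) : continuous (fun t : R => (Num.max t0 t) `^ e).
Proof.
move=> t; apply: (@continuous_comp _ _ _ (fun t => Num.max t0 t) (fun s => s `^ e)); first exact: continuous_maxt0.
have tt : 0 < Num.max t0 t by rewrite lt_max t0_gt0.
apply: (is_derive1_continuous _ _ (fun s : R => s `^ e) _ (e * (Num.max t0 t) `^ (e - 1))).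
exact: is_derive1_powR.
Qed.

(** * Weighted kinetic integrals *)

Definition kinetic_density (e t : R) : R := (Num.max t0 t) `^ e * `|extxd t| ^+ 2.

Lemma kinetic_densityE e t : t0 <= t -> kinetic_density e t = t `^ e * `|xd t| ^+ 2.
Proof. by move=> tt; rewrite /kinetic_density extxdE//; congr (_ `^ _ * _); apply/max_idPr. Qed.

Lemma kinetic_density_ge0 e t : 0 <= kinetic_density e t.
Proof. by rewrite mulr_ge0 ?powR_ge0 ?exprn_ge0. Qed.

Lemma continuous_kinetic_density e : continuous (kinetic_density e).
Proof.
move=> t; apply: cvgM; first exact: continuous_powR_max.
have E s : `|extxd s| ^+ 2 = <| extxd s, extxd s |> by rewrite -norm2E.
rewrite E; under eq_cvg do rewrite E.
by apply: cvg_ip; exact: continuous_extxd.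
Qed.

(** With exponent [- q] this is, up to the factor [alpha], the energy lost to friction; with
    exponent [1] it is the integral to be bounded. *)
Definition kinetic (e t : R) : R := \int[lebesgue_measure]_(r in `[t0, t]) kinetic_density e r.

Lemma kinetic_is_derive e t : t0 < t -> is_derive t 1 (kinetic e) (t `^ e * `|xd t| ^+ 2).
Proof.
by move=> tt; rewrite -kinetic_densityE ?ltW//; apply: is_derive_primitive => //; exact: continuous_kinetic_density.
Qed.

Lemma derive_ge0_nondecreasing (f df : R -> R) (a b : R) : a <= b ->
  (forall t, a <= t -> is_derive t 1 f (df t)) ->
  (forall t, a <= t -> 0 <= df t) -> f a <= f b.
Proof.
move=> ab fd df0.
have [c cst cE] : exists2 c, c \in `[a, b] & f b - f a = df c * (b - a).
  apply: (@MVT_segment _ f df) => //.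
    by move=> c; rewrite in_itv /= => /andP[sc ct]; apply: fd; exact: ltW.
  apply: continuous_in_subspaceT => c; rewrite inE /= in_itv /= => /andP[sc ct].
  by apply: (is_derive1_continuous _ _ _ _ _ (fd c _)).
rewrite -subr_ge0 cE mulr_ge0 ?subr_ge0//; apply: df0.
by move: cst; rewrite in_itv /= => /andP[].
Qed.

Lemma kinetic_nondecreasing e (a b : R) : t0 < a -> a <= b -> kinetic e a <= kinetic e b.
Proof.
move=> ta ab; apply: (derive_ge0_nondecreasing _ (fun t => t `^ e * `|xd t| ^+ 2)) => // t at_.
  by apply: kinetic_is_derive; exact: lt_le_trans at_.
by rewrite mulr_ge0 ?powR_ge0 ?exprn_ge0.
Qed.

(** * Domination of the quantities along the trajectory *)

Lemma dominated_derive_after (W : normedModType R) (ipW : inner_product W) (f df : R -> W) (a b : R) :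
  t0 < a -> a <= b ->
  (forall t, t0 < t -> is_derive t 1 f (df t)) ->
  (forall t, t0 < t -> {for t, continuous df}) -> dominated R H xd a b W f.
Proof.
move=> ta ab fd cdf; apply: (dominated_derive _ _ _ _ _ _ ipW f df ab) => t /andP[at_ _].
  by apply: fd; exact: lt_le_trans at_.
by apply: cdf; exact: lt_le_trans at_.
Qed.

Lemma xd_bounded (a b : R) : t0 < a -> a <= b -> exists B, forall t, a <= t <= b -> `|xd t| <= B.
Proof.
move=> ta ab; apply: continuous_bounded_itv => // t /andP[at_ _].
by apply: xd_cont; exact: lt_le_trans at_.
Qed.

Lemma dominated_mulr (f g : R -> R) (a b : R) : t0 < a -> a <= b ->
  dominated R H xd a b R^o f -> dominated R H xd a b R^o g ->
  dominated R H xd a b R^o (fun s => f s * g s).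
Proof.
move=> ta ab; have [B hB] := xd_bounded a b ta ab.
exact: (dominated_ip R H xd a b B ab hB R^o (real_ip R)).
Qed.

Lemma dominated_ip_after (f g : R -> H) (a b : R) : t0 < a -> a <= b ->
  dominated R H xd a b H f -> dominated R H xd a b H g ->
  dominated R H xd a b R^o (fun s => <| f s, g s |>).
Proof.
move=> ta ab; have [B hB] := xd_bounded a b ta ab.
exact: (dominated_ip R H xd a b B ab hB H ipH).
Qed.

Lemma dominated_trajectory (a b : R) : t0 < a -> a <= b -> dominated R H xd a b H x.
Proof. by move=> ta ab; apply: (dominated_derive_after _ ipH x xd) => //; exact: xd_cont. Qed.

Lemma dominated_powR e (a b : R) : t0 < a -> a <= b -> dominated R H xd a b R^o (fun s : R => s `^ e).
Proof.
move=> ta ab; apply: (dominated_derive_after _ (real_ip R) _ (fun t => e * t `^ (e - 1))) => // t tt.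
  exact: powR_is_derive.
by apply: cvgM; [exact: cvg_cst|exact: powR_cont].
Qed.

Lemma dominated_kinetic e (a b : R) : t0 < a -> a <= b -> dominated R H xd a b R^o (kinetic e).
Proof.
move=> ta ab; apply: (dominated_derive_after _ (real_ip R) _ (fun t => t `^ e * `|xd t| ^+ 2)) => // t tt.
  exact: kinetic_is_derive.
apply: cvgM; first exact: powR_cont.
rewrite (norm2E _ _ ipH); under eq_cvg do rewrite (norm2E _ _ ipH).
by apply: cvg_ip; exact: xd_cont.
Qed.

Lemma dominated_objective i (a b : R) : t0 < a -> a <= b -> dominated R H xd a b R^o (fun s => F i (x s)).
Proof.
move=> ta ab; apply: (dominated_derive_after _ (real_ip R) _ (fun t => <| gradF i (x t), xd t |>)) => // t tt.
  by apply: is_derive_gradient => //; exact: dx.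
(* The Lipschitz bound makes [gradF i (x t)] continuous in [t]; [|L| + 1] replaces [L] to have a
   positive constant. *)
have [L hL] := lipF i.
have cx := is_derive1_continuous _ _ _ _ _ (dx t tt).
apply: cvg_ip; last exact: xd_cont.
apply/cvgrPdist_le => e e0.
have L0 : 0 < `|L| + 1 by rewrite ltr_pwDr.
have /cvgrPdist_le /(_ (e / (`|L| + 1)) (divr_gt0 e0 L0)) := cx.
apply: filterS => s hs; apply: (le_trans (hL _ _)).
apply: (@le_trans _ _ ((`|L| + 1) * `|x t - x s|)).
  by rewrite ler_wpM2r// (le_trans (ler_norm _))// lerDl.
by rewrite mulrC -ler_pdivlMr.
Qed.

(** * The energies and their dissipation *)

Lemma ac_xd (a b : R) : t0 < a -> a <= b -> abs_cont_on a b xd.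
Proof.
move=> ta ab e e0; have [d d0 hd] := acxd b (le_trans (ltW ta) ab) e e0.
exists d => // n lo hi lohi; apply: hd => k; have [h1 h2] := lohi k; split => //.
by apply: le_trans h1; exact: ltW.
Qed.

(* [<| x, x |>] and [<| xd, xd |>] stand for the squared norms. *)
Definition W i t : R := F i (x t) + (beta / 2 * (t `^ (-2) * <| x t, x t |>) + 2^-1 * <| xd t, xd t |>).

(** In the derivative, the products with [xd] assemble into the tested inequality of [eqn], which
    cancels the kinetic term. What remains comes from the decay of the weight:
    [- beta t^-3 |x|^2 <= 0]. *)
Lemma W_kinetic_nonincreasing i (a b : R) : t0 < a -> a <= b ->
  W i b + alpha * kinetic (- q) b <= W i a + alpha * kinetic (- q) a.
Proof.
move=> ta ab; apply: (ae_nonincreasing _ _ xd (fun t => W i t + alpha * kinetic (- q) t)) => //.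
- exact: ac_xd.
- have D := dominatedD R H xd a b R^o.
  have S (c : R) (f : R -> R) : dominated R H xd a b R^o f -> dominated R H xd a b R^o (fun s => c * f s).
    by apply: dominated_mulr => //; exact: dominated_cst.
  apply: (D); last by apply: (S); exact: dominated_kinetic.
  apply: (D (fun s => F i (x s))); first exact: dominated_objective.
  apply: (D); apply: (S).
    by apply: dominated_mulr => //; [exact: dominated_powR|apply: (dominated_ip_after x x) => //; exact: dominated_trajectory].
  by apply: (dominated_ip_after xd xd) => //; exact: dominated_self.
- have FF := ae_filter_ringOfSetsType (@lebesgue_measure R).
  have := @filterI _ _ FF _ _ dxd eqn; apply: (@filterS _ _ FF) => t [dxdt eqnt] at_.
  have tt := lt_le_trans ta at_.
  have [/(_ i) + _] := eqnt tt; rewrite !ipDl ipZl => h.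
  pose c := <| gradF i (x t), xd t |> + (beta / 2 * ((- 2 * t `^ (-2 - 1)) * <| x t, x t |> +
     t `^ (-2) * (<| xd t, x t |> + <| x t, xd t |>)) + 2^-1 * (<| xdd t, xd t |> + <| xd t, xdd t |>)) +
     alpha * (t `^ (- q) * `|xd t| ^+ 2).
  exists c; last first.
    have dxt := dx t tt; have dxdt' := dxdt tt.
    apply: is_derive_addf; last by apply: is_derive_scalef; exact: kinetic_is_derive.
    apply: is_derive_addf; first exact: is_derive_gradient.
    apply: is_derive_addf; apply: is_derive_scalef; last exact: is_derive_ip.
    by apply: is_derive_mulf; [exact: powR_is_derive|exact: is_derive_ip].
  have : 0 <= beta * (t `^ (-2 - 1) * <| x t, x t |>).
    by rewrite !mulr_ge0 ?powR_ge0 ?ip_ge0// ltW.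
  move: h; rewrite /c (ip_sym _ (xd t) (x t)) (ip_sym _ (xd t) (xdd t)); lra.
Qed.

Lemma W_nonincreasing i (a b : R) : t0 < a -> a <= b -> W i b <= W i a.
Proof.
move=> ta ab; have := W_kinetic_nonincreasing i a b ta ab.
have := kinetic_nondecreasing (- q) a b ta ab; rewrite -(ler_pM2l alpha_gt0); lra.
Qed.

(** The tangent of [F i] at [0] and the bound [M] on the trajectory control [F i (x t)] from below;
    the other two terms are nonnegative. *)
Lemma W_bounded_below i : exists B, forall t, t0 < t -> B <= W i t.
Proof.
exists (F i 0 - `|gradF i 0| * M) => t tt.
have h := convex_gradient_le R H ipH (F i) (gradF i) 0 (x t) (cvxF i) (gradFP i).
have h1 := ip_CauchySchwarz R H ipH (gradF i 0) (x t).
have h2 : `|gradF i 0| * `|x t| <= `|gradF i 0| * M by rewrite ler_wpM2l// xM// ltW.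
have h3 : 0 <= beta / 2 * (t `^ (-2) * <| x t, x t |>).
  by rewrite !mulr_ge0 ?invr_ge0 ?powR_ge0 ?ip_ge0// ltW.
have h4 := ip_ge0 R H ipH (xd t).
move: h h1; rewrite /W subr0 ler_norml => h /andP[h1 _]; lra.
Qed.

(** * The dissipation tail and the limits of the energies *)

Variable i0 : 'I_m.

Definition kinetic_sup : R := sup [set kinetic (- q) t | t in [set t | t0 < t]].

(** A single energy [W i0] suffices: what it dissipates after [t1] cannot exceed its distance to the
    lower bound [B]. *)
Lemma has_sup_kinetic : has_sup [set kinetic (- q) t | t in [set t | t0 < t]].
Proof.
have [B hB] := W_bounded_below i0.
pose t1 := t0 + 1; have t1_gt : t0 < t1 by rewrite ltrDl.
split; first by exists (kinetic (- q) t1), t1.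
exists ((W i0 t1 + alpha * kinetic (- q) t1 - B) / alpha) => _ [t tt <-].
have tm : t0 < Num.max t t1 by rewrite lt_max tt.
apply: (@le_trans _ _ (kinetic (- q) (Num.max t t1))).
  by apply: kinetic_nondecreasing => //; rewrite le_max lexx.
rewrite ler_pdivlMr//.
have := W_kinetic_nonincreasing i0 t1 (Num.max t t1) t1_gt; rewrite le_max lexx orbT => /(_ isT).
have := hB _ tm; lra.
Qed.

(* The tail [alpha * int_t^oo s^-q |xd s|^2 ds].  It serves as a continuously differentiable
   lower bound for the nonsmooth gap [min_i (W i t - F i z)]. *)
Definition rho t : R := alpha * (kinetic_sup - kinetic (- q) t).

Lemma rho_ge0 t : t0 < t -> 0 <= rho t.
Proof.
move=> tt; rewrite mulr_ge0 ?(ltW alpha_gt0)// subr_ge0.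
by apply: (ub_le_sup has_sup_kinetic.2); exists t.
Qed.

Lemma rho_is_derive t : t0 < t -> is_derive t 1 rho (- alpha * (t `^ (- q) * `|xd t| ^+ 2)).
Proof.
move=> tt; have d := kinetic_is_derive (- q) t tt.
have := is_derive_addf _ _ _ _ _ _ (is_derive_cstf _ t (alpha * kinetic_sup))
   (is_derive_scalef _ _ _ _ (- alpha) d).
rewrite add0r; congr (is_derive _ _ _ _); apply/funext => s; rewrite /rho; ring.
Qed.

Definition Winf i : R := inf [set W i t | t in [set t | t0 < t]].

Lemma has_inf_W i : has_inf [set W i t | t in [set t | t0 < t]].
Proof.
have [B hB] := W_bounded_below i.
by split; [exists (W i (t0 + 1)), (t0 + 1) => //=; rewrite ltrDl | exists B => _ [t tt <-]; exact: hB].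
Qed.

Lemma Winf_le i t : t0 < t -> Winf i <= W i t.
Proof. by move=> tt; apply: (ge_inf (has_inf_W i).2); exists t. Qed.

(** Between [t] and a late time, [W i] loses at least [alpha] times the growth of [kinetic (- q)],
    which is within [e] of [rho t] once the late time nearly realises [kinetic_sup]. *)
Lemma Winf_rho_le i t : t0 < t -> Winf i + rho t <= W i t.
Proof.
move=> tt; apply/ler_addgt0Pl => e e0.
have [_ [s ts <-] hs] := sup_adherent (divr_gt0 e0 alpha_gt0) has_sup_kinetic.
rewrite -/kinetic_sup in hs.
have tm : t0 < Num.max t s by rewrite lt_max tt.
have h1 : kinetic (- q) s <= kinetic (- q) (Num.max t s).
  by apply: kinetic_nondecreasing => //; rewrite le_max lexx orbT.
have h2 := Winf_le i _ tm.
have := W_kinetic_nonincreasing i t (Num.max t s) tt; rewrite le_max lexx => /(_ isT) h3.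
have h4 : alpha * (kinetic_sup - kinetic (- q) (Num.max t s)) <= e.
  by rewrite mulrC -ler_pdivlMr//; move: h1 hs; lra.
by rewrite /rho; move: h2 h3 h4; lra.
Qed.

(** The minimiser [z] does at least as well as every [x t]. Since [F i (x t) <= W i t], the shifted
    maximum at [x t] is at most [e] for late [t]. *)
Lemma Sargmin_le_Winf z : Sargmin F Winf z -> forall i, F i z <= Winf i.
Proof.
move=> hz i; apply/ler_addgt0Pl => e e0.
have /choice [T hT] : forall j, exists t, t0 < t /\ W j t < Winf j + e.
  move=> j; have [_ [t tt <-] ht] := inf_adherent e0 (has_inf_W j).
  by exists t.
(* All [T j] are positive, so their sum is a common later time. *)
pose t := \sum_j T j.
have Tt j : T j <= t.
  rewrite /t (bigD1 j)//= lerDl sumr_ge0// => k _.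
  by have [h _] := hT k; rewrite ltW// (lt_trans t0_gt0).
have tt : t0 < t by apply: lt_le_trans (Tt i0); have [] := hT i0.
have : (maxshift F Winf z <= e%:E)%E.
  apply: (le_trans (hz (x t))); apply: bigmax_le => [|j _]; first exact: leNye.
  rewrite lee_fin lerBlDr.
  have [h1 h2] := hT j; have h3 := W_nonincreasing j (T j) t h1 (Tt j).
  have h4 : 0 <= beta / 2 * (t `^ (-2) * <| x t, x t |>).
    by rewrite !mulr_ge0 ?invr_ge0 ?powR_ge0 ?ip_ge0// ltW.
  have h5 := ip_ge0 R H ipH (xd t).
  by move: h2 h3; rewrite {2}/W; lra.
move=> h; have : ((F i z - Winf i)%:E <= e%:E)%E.
  by apply: le_trans h; exact: (le_bigmax _ (fun j => (F j z - Winf j)%:E)).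
by rewrite lee_fin lerBlDr.
Qed.

(** * Distance to a point below all energy limits *)

Variable z : H.
Hypothesis Fz : forall i, F i z <= Winf i.

Lemma powR_sum (t a b : R) : t0 < t -> t `^ (a + b) = t `^ a * t `^ b.
Proof.
move=> tt; rewrite powRD//; apply/implyP => _.
by rewrite gt_eqF//; exact: lt_trans tt.
Qed.

Definition halfdist t : R := 2^-1 * <| x t - z, x t - z |>.

Lemma halfdist_ge0 t : 0 <= halfdist t.
Proof. by rewrite mulr_ge0 ?invr_ge0 ?ip_ge0. Qed.

Lemma halfdist_le t : t0 < t -> halfdist t <= 2^-1 * (M + `|z|) ^+ 2.
Proof.
move=> tt; rewrite ler_pM2l ?invr_gt0// -(norm2E _ _ ipH) ler_sqr ?nnegrE//.
  by apply: (le_trans (ler_normB _ _)); rewrite lerD2r xM// ltW.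
by rewrite addr_ge0//; apply: le_trans (xM t0 _).
Qed.

Lemma is_derive_xz t : t0 < t -> is_derive t 1 (fun s => x s - z) (xd t).
Proof.
move=> tt; have d := dx t tt.
rewrite -[xd t]subr0; exact: (is_deriveB d (is_derive_cst z t 1)).
Qed.

Lemma halfdist_is_derive t : t0 < t -> is_derive t 1 halfdist <| x t - z, xd t |>.
Proof.
move=> tt; have d := is_derive_xz t tt.
apply: is_derive_eq; first by apply: is_derive_scalef; exact: is_derive_ip.
by rewrite (ip_sym _ (xd t)); lra.
Qed.

(** Convexity at [x t] and [Winf_rho_le] bound each [<gradF i (x t), x t - z>] from below, and the
    weights [l] average these bounds. In [2 <x - z, x> = |x|^2 + |x - z|^2 - |z|^2], the first term
    cancels the potential part of [W] and the second is dropped by sign. *)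
Lemma radial_acceleration_le t (l : 'I_m -> R) : t0 < t ->
  (forall i, 0 <= l i) -> \sum_(i < m) l i = 1 ->
  xdd t = - ((alpha * t `^ (- q)) *: xd t) - (beta * t `^ (-2)) *: x t
               - \sum_(i < m) l i *: gradF i (x t) ->
  <| x t - z, xdd t |> <= - (alpha * t `^ (- q) * <| x t - z, xd t |>) - rho t
     + beta / 2 * (t `^ (-2) * <| z, z |>) + 2^-1 * <| xd t, xd t |>.
Proof.
move=> tt l0 l1 xddE.
have -> : <| x t - z, xdd t |> = - (alpha * t `^ (- q) * <| x t - z, xd t |>) -
    beta * t `^ (-2) * <| x t - z, x t |> - <| x t - z, \sum_(i < m) l i *: gradF i (x t) |>.
  by rewrite xddE !ipBr ipNr !ipZr.
have h : rho t - beta / 2 * (t `^ (-2) * <| x t, x t |>) - 2^-1 * <| xd t, xd t |>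
    <= <| x t - z, \sum_(i < m) l i *: gradF i (x t) |>.
  have E (k : R) : k = \sum_(i < m) l i * k by rewrite -mulr_suml l1 mul1r.
  rewrite ip_sym ip_suml [X in X <= _]E; apply: ler_sum => i _.
  rewrite ipZl ler_wpM2l//.
  have := convex_gradient_le R H ipH (F i) (gradF i) (x t) z (cvxF i) (gradFP i).
  rewrite !ipBr; have := Winf_rho_le i t tt; have := Fz i; rewrite /W; lra.
have : 0 <= beta * (t `^ (-2) * <| x t - z, x t - z |>).
  by rewrite !mulr_ge0 ?powR_ge0 ?ip_ge0// ltW.
move: h; rewrite !(ipBl, ipBr) (ip_sym _ z (x t)).
lra.
Qed.

(* The antiderivative of [t^q rho t] obtained by parts from [rho' = - alpha t^-q |xd|^2]. *)
Definition residual t : R := (alpha * kinetic 1 t + t `^ (1 + q) * rho t) / (1 + q).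

Lemma residual_is_derive t : t0 < t -> is_derive t 1 residual (t `^ q * rho t).
Proof.
move=> tt.
have d := is_derive_addf _ _ _ _ _ _ (is_derive_scalef _ _ _ _ alpha (kinetic_is_derive 1 t tt))
  (is_derive_mulf _ _ _ _ _ _ (powR_is_derive t (1 + q) tt) (rho_is_derive t tt)).
rewrite (_ : residual = (fun s => (1 + q)^-1 * (alpha * kinetic 1 s + s `^ (1 + q) * rho s))).
  2: by apply/funext => s; rewrite /residual mulrC.
apply: is_derive_eq; rewrite /GRing.scale /=.
rewrite (_ : 1 + q - 1 = q); last by ring.
have q1 : 1 + q != 0 by rewrite gt_eqF//; case/andP: q01; lra.
have -> : t `^ 1 = t `^ (1 + q) * t `^ (- q) by rewrite -powR_sum//; congr (_ `^ _); ring.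
by field.
Qed.

Lemma residual_nondecreasing (a b : R) : t0 < a -> a <= b -> residual a <= residual b.
Proof.
move=> ta ab; apply: (derive_ge0_nondecreasing _ (fun t => t `^ q * rho t)) => // t at_.
  by apply: residual_is_derive; exact: lt_le_trans at_.
by rewrite mulr_ge0 ?powR_ge0 ?rho_ge0//; exact: lt_le_trans at_.
Qed.

(** Sum of the coefficients of [t^(q-2)]: one from the [|z|^2] term of the radial estimate, one from
    [q (1 - q) t^(q-2) h] with [h] replaced by its upper bound. *)
Definition lyapunov_cst : R := beta / 2 * <| z, z |> + q * (1 - q) * (2^-1 * (M + `|z|) ^+ 2).

(* With [h = halfdist], [t^q h' - q t^(q-1) h + alpha h] integrates [t^q (h'' + alpha t^-q h')]
   up to [q (1 - q) t^(q-2) h]; the [rho] term absorbs [3/2 t^q |xd|^2], [residual / 2] keeps half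
   of [int t^q rho], and the last term absorbs the [O(t^(q-2))] remainders. *)
Definition lyapunov t : R := t `^ q * <| x t - z, xd t |> +
  ((alpha - q * t `^ (q - 1)) * halfdist t +
  (3 / (2 * alpha) * (t `^ (q + q) * rho t) +
  (2^-1 * residual t + lyapunov_cst / (1 - q) * t `^ (q - 1)))).

(** The radial estimate contributes [- t^q rho]. Half of it pays for the derivative of
    [residual / 2]; the other half pays for [(3 q / alpha) t^(2q-1) rho], and the threshold on
    [t^(q-1)] is exactly what this requires. *)
Lemma lyapunov_derive_le0 (t : R) (l : 'I_m -> R) : t0 < t -> t `^ (q - 1) <= alpha / (6 * q) ->
  is_derive t 1 xd (xdd t) ->
  (forall i, 0 <= l i) -> \sum_(i < m) l i = 1 ->
  xdd t = - ((alpha * t `^ (- q)) *: xd t) - (beta * t `^ (-2)) *: x t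
               - \sum_(i < m) l i *: gradF i (x t) ->
  exists2 c, c <= 0 & is_derive t 1 lyapunov c.
Proof.
move=> tt P1le dxdt l0 l1 xddE; case/andP: (q01) => q0 q1.
have tgt0 : 0 < t by apply: lt_trans tt.
have rad := radial_acceleration_le t l tt l0 l1 xddE.
pose c := q * t `^ (q - 1) * <| x t - z, xd t |> + t `^ q * (<| xd t, xd t |> + <| x t - z, xdd t |>) +
  ((0 + (- q) * ((q - 1) * t `^ (q - 1 - 1))) * halfdist t + (alpha + - q * t `^ (q - 1)) * <| x t - z, xd t |> +
   (3 / (2 * alpha) * ((q + q) * t `^ (q + q - 1) * rho t + t `^ (q + q) * (- alpha * (t `^ (- q) * `|xd t| ^+ 2))) +
    (2^-1 * (t `^ q * rho t) + lyapunov_cst / (1 - q) * ((q - 1) * t `^ (q - 1 - 1))))).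
exists c; last first.
  have dxt := is_derive_xz t tt; have dxdt' := dxdt.
  apply: is_derive_addf.
    by apply: is_derive_mulf; [exact: powR_is_derive|exact: (is_derive_ip _ _ _ (fun s => x s - z))].
  apply: is_derive_addf.
    have dP : is_derive t 1 (fun s : R => alpha - q * s `^ (q - 1))
        (0 + (- q) * ((q - 1) * t `^ (q - 1 - 1))).
      rewrite (_ : (fun s => _) = (fun s : R => alpha + (- q) * s `^ (q - 1))).
        apply: (is_derive_addf R (fun=> alpha) (fun s : R => (- q) * s `^ (q - 1))).
        by apply: is_derive_scalef; exact: powR_is_derive.
      by apply/funext => s; rewrite mulNr.
    rewrite (_ : alpha + - q * t `^ (q - 1) = alpha - q * t `^ (q - 1)); last by rewrite mulNr.
    exact: (is_derive_mulf _ _ _ _ _ _ dP (halfdist_is_derive t tt)).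
  apply: is_derive_addf.
    apply: is_derive_scalef; apply: is_derive_mulf; [exact: powR_is_derive|exact: rho_is_derive].
  apply: is_derive_addf; apply: is_derive_scalef; [exact: residual_is_derive|exact: powR_is_derive].
rewrite /c (norm2E _ _ ipH).
have E1 : t `^ (q + q - 1) = t `^ q * t `^ (q - 1) by rewrite -powR_sum//; congr (_ `^ _); ring.
have E2 : t `^ (q + q) = t `^ q * t `^ q by rewrite -powR_sum.
have E3 : t `^ q * t `^ (- q) = 1 by rewrite -powR_sum// subrr powRr0.
have E4 : t `^ (q - 1 - 1) = t `^ q * t `^ (-2) by rewrite -powR_sum//; congr (_ `^ _); ring.
have Ppos := powR_gt0 q tgt0; have P2 := powR_ge0 t (-2).
have rad2 := ler_wpM2l (ltW Ppos) rad.
have hle := halfdist_le t tt.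
have r0 := rho_ge0 t tt.
rewrite E1 E2 E4; move: rad2 E3 P1le hle; rewrite /lyapunov_cst.
(* Naming the powers and inner products reduces the rest to an inequality that is linear in their
   monomials. *)
set P := t `^ q; set Pm := t `^ (- q); set P1 := t `^ (q - 1); set T2 := t `^ (-2).
set N := <| xd t, xd t |>; set hd := <| x t - z, xd t |>; set DD := <| x t - z, xdd t |>.
set Z := <| z, z |>; set h := halfdist t; set Hm := 2^-1 * (M + `|z|) ^+ 2; set r := rho t.
move=> rad2 E3 P1le hle.
have e1 : P * (- (alpha * Pm * hd) - r + beta / 2 * (T2 * Z) + 2^-1 * N) =
   - (alpha * hd) - P * r + beta / 2 * (P * T2 * Z) + 2^-1 * (P * N).
  by rewrite -[in RHS](mul1r (alpha * hd)) -E3; ring.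
rewrite e1 in rad2.
have e2 : 3 / (2 * alpha) * ((q + q) * (P * P1) * r + P * P * (- alpha * (Pm * N))) =
   3 * q / alpha * (P * P1 * r) - 3 / 2 * (P * N).
  have -> : P * P * (- alpha * (Pm * N)) = - alpha * (P * N) by rewrite -[in RHS](mul1r (P * N)) -E3; ring.
  by field; rewrite gt_eqF.
rewrite e2.
have e3 : (beta / 2 * Z + q * (1 - q) * Hm) / (1 - q) * ((q - 1) * (P * T2)) =
   - (beta / 2 * Z + q * (1 - q) * Hm) * (P * T2).
  by field; rewrite gt_eqF// subr_gt0.
rewrite e3.
have e4 : 3 * q / alpha * (P * P1 * r) <= 2^-1 * (P * r).
  have -> : 3 * q / alpha * (P * P1 * r) = (3 * q / alpha * P1) * (P * r) by ring.
  rewrite ler_wpM2r//; first by rewrite mulr_ge0// ltW.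
  have k0 : 0 <= 3 * q / alpha by rewrite divr_ge0 ?mulr_ge0// ltW.
  apply: (le_trans (ler_wpM2l k0 P1le)).
  rewrite le_eqVlt; apply/orP; left; apply/eqP; field; rewrite ?gt_eqF//.
have e5 : q * (1 - q) * (P * T2) * h <= q * (1 - q) * (P * T2) * Hm.
  by rewrite ler_wpM2l// !mulr_ge0 ?subr_ge0// ltW.
lra.
Qed.

Lemma lyapunov_nonincreasing (a b : R) : t0 < a -> a <= b -> a `^ (q - 1) <= alpha / (6 * q) -> lyapunov b <= lyapunov a.
Proof.
move=> ta ab aq; case/andP: q01 => q0 q1.
apply: (ae_nonincreasing _ _ xd lyapunov) => //.
- exact: ac_xd.
- have D := dominatedD R H xd a b R^o.
  have S (c : R) (f : R -> R) : dominated R H xd a b R^o f -> dominated R H xd a b R^o (fun s => c * f s).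
    by apply: dominated_mulr => //; exact: dominated_cst.
  have dxz : dominated R H xd a b H (fun s => x s - z).
    by apply: dominatedD; [exact: dominated_trajectory|exact: dominated_cst].
  have dh : dominated R H xd a b R^o halfdist by apply: (S); apply: (dominated_ip_after (fun s => x s - z) (fun s => x s - z)).
  have dr : dominated R H xd a b R^o rho.
    apply: (S); apply: (D); first exact: dominated_cst.
    rewrite (_ : (fun s => - kinetic (- q) s) = (fun s => (-1) * kinetic (- q) s)); last by apply/funext => s; rewrite mulN1r.
    by apply: (S); exact: dominated_kinetic.
  have dp e := dominated_powR e a b ta ab.
  apply: (D).
    by apply: dominated_mulr => //; apply: (dominated_ip_after (fun s => x s - z) xd) => //; exact: dominated_self.
  apply: (D).
    apply: dominated_mulr => //; apply: (D); first exact: dominated_cst.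
    rewrite (_ : (fun s => - (q * s `^ (q - 1))) = (fun s => (- q) * s `^ (q - 1))); last by apply/funext => s; rewrite mulNr.
    exact: (S).
  apply: (D); first by apply: (S); exact: dominated_mulr.
  apply: (D); apply: (S) => //.
  rewrite (_ : residual = (fun s => (1 + q)^-1 * (alpha * kinetic 1 s + s `^ (1 + q) * rho s))).
    by apply: (S); apply: (D); [apply: (S); exact: dominated_kinetic|exact: dominated_mulr].
  by apply/funext => s; rewrite /residual mulrC.
- have FF := ae_filter_ringOfSetsType (@lebesgue_measure R).
  have := @filterI _ _ FF _ _ dxd eqn; apply: (@filterS _ _ FF) => t [dxdt eqnt] at_.
  have tt := lt_le_trans ta at_; have [_ [l [l0 [l1 xddE]]]] := eqnt tt.
  apply: (lyapunov_derive_le0 t l) => //; last exact: dxdt.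
  (* Since [q - 1] is negative, the threshold at [a] persists at later times. *)
  apply: le_trans aq; rewrite -opprB !powRN lef_pV2 ?posrE ?powR_gt0//; last exact: lt_trans ta.
    by rewrite ge0_ler_powR ?nnegrE ?subr_ge0// ltW// (lt_trans t0_gt0).
  exact: lt_trans tt.
Qed.

(** * Boundedness of the kinetic integral with weight [s] *)

Lemma powR_eventually_ge (e y : R) : 0 < e -> exists2 a : R, t0 < a & forall t, a <= t -> y <= t `^ e.
Proof.
move=> e0; have y0 : 0 < `|y| + 1 by rewrite ltr_pwDr.
exists (Num.max (t0 + 1) ((`|y| + 1) `^ (e^-1))); first by rewrite lt_max ltrDl ltr01.
move=> t; rewrite ge_max => /andP[_ ht].
apply: (@le_trans _ _ (`|y| + 1)); first by rewrite (le_trans (ler_norm _))// lerDl.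
have -> : `|y| + 1 = ((`|y| + 1) `^ (e^-1)) `^ e.
  by rewrite -powRrM mulVf ?gt_eqF// powRr1// ltW.
by rewrite ge0_ler_powR ?nnegrE ?powR_ge0// ?(le_trans _ ht) ?powR_ge0// ltW.
Qed.

Lemma residual_bounded (a : R) : t0 < a -> a `^ (q - 1) <= alpha / (6 * q) ->
  exists C, forall t, a <= t -> residual t <= C.
Proof.
move=> ta aq; case/andP: (q01) => q0 q1.
have agt0 := lt_trans t0_gt0 ta.
have q1' : 0 < 1 - q by rewrite subr_gt0.
pose Hm := 2^-1 * (M + `|z|) ^+ 2.
have Mz0 : 0 <= M + `|z| by rewrite addr_ge0//; apply: le_trans (xM t0 _).
(* The only term of [lyapunov t] beyond the first without a favourable sign is [- q t^(q-1) h]; the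
   second summand bounds its size uniformly for [t >= a]. *)
pose C2 := lyapunov a + q * a `^ (q - 1) * Hm.
have bound t : a <= t -> t `^ q * <| x t - z, xd t |> <= C2 - 2^-1 * residual t.
  move=> at_; have tt := lt_le_trans ta at_; have tgt0 := lt_trans t0_gt0 tt.
  have := lyapunov_nonincreasing a t ta at_ aq; rewrite {1}/lyapunov /C2.
  have h1 : 0 <= 3 / (2 * alpha) * (t `^ (q + q) * rho t).
    apply: mulr_ge0; last by rewrite mulr_ge0 ?powR_ge0 ?rho_ge0.
    by apply: divr_ge0 => //; rewrite mulr_ge0 ?ltW.
  have h2 : 0 <= lyapunov_cst / (1 - q) * t `^ (q - 1).
    rewrite mulr_ge0 ?powR_ge0// divr_ge0 ?(ltW q1')//.
    apply: addr_ge0; first by rewrite mulr_ge0 ?ip_ge0// divr_ge0 ?ltW.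
    by rewrite !mulr_ge0 ?exprn_ge0 ?invr_ge0 ?(ltW q0) ?(ltW q1').
  have h3 : q * t `^ (q - 1) * halfdist t <= q * a `^ (q - 1) * Hm.
    apply: ler_pM; rewrite ?halfdist_ge0 ?halfdist_le ?mulr_ge0 ?powR_ge0 ?(ltW q0)//.
    rewrite ler_wpM2l ?(ltW q0)// -opprB !powRN lef_pV2 ?posrE ?powR_gt0//.
    by apply: ge0_ler_powR; rewrite ?nnegrE ?(ltW q1') ?(ltW agt0) ?(ltW tgt0).
  have h4 : 0 <= alpha * halfdist t by rewrite mulr_ge0 ?halfdist_ge0 ?ltW.
  lra.
(* A residual above [2 * C2 + 2] makes [C2 - residual / 2] less than [-1], so [t^q h' <= -1] from
   [T] on. *)
apply: contrapT => /forallNP /(_ (2 * C2 + 2)) /existsNP[T /not_implyP[aT /negP]].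
rewrite -ltNge => hT.
have t0T := lt_le_trans ta aT.
have drift t : T <= t -> <| x t - z, xd t |> + t `^ (- q) <= 0.
  move=> Tt; have tt := lt_le_trans t0T Tt.
  have tgt0 := lt_trans t0_gt0 tt.
  have h1 := bound t (le_trans aT Tt).
  have h2 := residual_nondecreasing T t t0T Tt.
  have E3 : t `^ q * t `^ (- q) = 1 by rewrite -powR_sum// subrr powRr0.
  rewrite -(ler_pM2l (powR_gt0 q tgt0)) mulr0 mulrDr E3; lra.
have decr t : T <= t -> halfdist t + (1 - q)^-1 * t `^ (1 - q) <= halfdist T + (1 - q)^-1 * T `^ (1 - q).
  move=> Tt; rewrite -lerN2.
  apply: (derive_ge0_nondecreasing (fun t => - (halfdist t + (1 - q)^-1 * t `^ (1 - q)))
    (fun t => - (<| x t - z, xd t |> + t `^ (- q)))) => // s Ts; last by rewrite oppr_ge0 drift.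
  have ss := lt_le_trans t0T Ts.
  apply: is_deriveN; apply: is_derive_addf; first exact: halfdist_is_derive.
  have -> : s `^ (- q) = (1 - q)^-1 * ((1 - q) * s `^ (1 - q - 1)).
    by rewrite mulKf ?gt_eqF//; congr (_ `^ _); ring.
  by apply: is_derive_scalef; exact: powR_is_derive.
(* Past [b], the term [t^(1-q) / (1 - q)] exceeds the right side of [decr] by one, which would force
   [halfdist] to be negative. *)
have [b tb hb] := powR_eventually_ge (1 - q)
  ((1 - q) * (halfdist T + (1 - q)^-1 * T `^ (1 - q) + 1)) q1'.
have Tm : T <= Num.max T b by rewrite le_max lexx.
have := decr _ Tm.
have := hb (Num.max T b); rewrite le_max lexx orbT => /(_ isT).
rewrite -ler_pdivlMl//.
have := halfdist_ge0 (Num.max T b); lra.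
Qed.

(** In [residual] the term with [rho] is nonnegative, so a bound on [residual] bounds
    [alpha * kinetic 1]. Times before [a] are covered by monotonicity. *)
Lemma kinetic1_bounded : exists C, forall t, t0 < t -> kinetic 1 t <= C.
Proof.
case/andP: (q01) => q0 q1.
have q1' : 0 < 1 - q by rewrite subr_gt0.
have [a ta ha] := powR_eventually_ge (1 - q) (6 * q / alpha) q1'.
have agt0 := lt_trans t0_gt0 ta.
have aq : a `^ (q - 1) <= alpha / (6 * q).
  rewrite -opprB powRN -[alpha / _]invf_div lef_pV2 ?posrE ?powR_gt0 ?divr_gt0 ?mulr_gt0//.
  exact: ha.
have [C hC] := residual_bounded a ta aq.
exists ((1 + q) * C / alpha) => t tt.
have tm : t0 < Num.max t a by rewrite lt_max tt.
apply: (@le_trans _ _ (kinetic 1 (Num.max t a))).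
  by apply: kinetic_nondecreasing => //; rewrite le_max lexx.
rewrite ler_pdivlMr//.
have := hC (Num.max t a); rewrite le_max lexx orbT => /(_ isT).
rewrite /residual ler_pdivrMr; last by lra.
have : 0 <= (Num.max t a) `^ (1 + q) * rho (Num.max t a).
  by apply: mulr_ge0; [exact: powR_ge0|exact: rho_ge0].
lra.
Qed.

(** * Integrals over the half-line *)

Lemma kinetic_density_le e t : t0 <= t -> e <= 1 -> kinetic_density e t <= t0 `^ (e - 1) * kinetic_density 1 t.
Proof.
move=> tt e1; rewrite !kinetic_densityE// mulrA ler_wpM2r ?exprn_ge0//.
have tgt0 := lt_le_trans t0_gt0 tt.
have -> : t `^ e = t `^ (e - 1) * t `^ 1.
  by rewrite -powRD ?subrK//; apply/implyP => _; rewrite gt_eqF.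
rewrite ler_wpM2r ?powR_ge0// -opprB !powRN lef_pV2 ?posrE ?powR_gt0//.
by apply: ge0_ler_powR; rewrite ?nnegrE ?subr_ge0 ?(ltW t0_gt0) ?(ltW tgt0).
Qed.

Lemma measurable_kinetic_density e (D : set R) : measurable_fun D (kinetic_density e).
Proof.
apply: measurable_funTS.
by apply: continuous_measurable_fun; exact: continuous_kinetic_density.
Qed.

Lemma kineticE e (t : R) : (\int[lebesgue_measure]_(s in `[t0, t]) (kinetic_density e s)%:E = (kinetic e t)%:E)%E.
Proof.
rewrite /kinetic /Rintegral fineK//; apply: integrable_fin_num => //.
apply: continuous_compact_integrable; first exact: segment_compact.
by apply: continuous_subspaceT; exact: continuous_kinetic_density.
Qed.

(** Monotone convergence along the intervals [[t0, t0 + k]] passes the uniform bound on [kinetic 1]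
    to the whole half-line. *)
Lemma integral_kinetic_density1 : (\int[lebesgue_measure]_(s in `[t0, +oo[) (kinetic_density 1 s)%:E < +oo)%E.
Proof.
have [C hC] := kinetic1_bounded.
apply: (@le_lt_trans _ _ C%:E); last exact: ltry.
rewrite itv_bndy_bigcup_BRight.
pose J (k : nat) : set R := `[t0, t0 + k%:R]%classic.
have cv : (\int[lebesgue_measure]_(s in J k) (kinetic_density 1 s)%:E @[k --> \oo] -->
    \int[lebesgue_measure]_(s in \bigcup_k J k) (kinetic_density 1 s)%:E)%E.
  apply: ge0_nondecreasing_set_cvg_integral.
  - move=> k l kl; apply/subsetPset; apply: subset_itvl.
    by rewrite bnd_simp lerD2l ler_nat.
  - by move=> k; exact: measurable_itv.
  - by move=> k; apply/measurable_EFinP; exact: measurable_kinetic_density.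
  - by move=> k s _; rewrite lee_fin kinetic_density_ge0.
rewrite -(cvg_lim _ cv)//; apply: lime_le; first by apply/cvg_ex; eexists; exact: cv.
near=> k; rewrite kineticE lee_fin; apply: hC.
by rewrite ltrDl ltr0n; near: k; exact: nbhs_infty_gt.
Unshelve. all: by end_near. Qed.

Lemma integral_kinetic_density e : e <= 1 ->
  (\int[lebesgue_measure]_(s in `[t0, +oo[) (kinetic_density e s)%:E < +oo)%E.
Proof.
move=> e1.
apply: (@le_lt_trans _ _ (\int[lebesgue_measure]_(s in `[t0, +oo[) ((t0 `^ (e - 1))%:E * (kinetic_density 1 s)%:E))%E).
  apply: ge0_le_integral => //.
  - by move=> s _; rewrite lee_fin kinetic_density_ge0.
  - by apply/measurable_EFinP; exact: measurable_kinetic_density.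
  - by apply: measurable_funeM; apply/measurable_EFinP; exact: measurable_kinetic_density.
  - by move=> s; rewrite /= in_itv /= andbT => ts; rewrite -EFinM lee_fin kinetic_density_le.
rewrite ge0_integralZl_EFin ?powR_ge0//.
- apply: lte_mul_pinfty; rewrite ?lee_fin ?powR_ge0//; exact: integral_kinetic_density1.
- by move=> s _; rewrite lee_fin kinetic_density_ge0.
- by apply/measurable_EFinP; exact: measurable_kinetic_density.
Qed.

End Trajectory.

(** Otherwise the null set would contain []t0, t0 + 1]], whose measure is one. *)
Lemma ae_gt_exists (R : realType) (t0 : R) (P : R -> Prop) :
  {ae lebesgue_measure, forall t, t0 < t -> P t} -> exists2 t, t0 < t & P t.
Proof.
move=> [N [mN N0 hN]]; apply: contrapT => noP.
have sub : `]t0, t0 + 1] `<=` N.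
  move=> t; rewrite /= in_itv /= => /andP[tt _]; apply: hN => /= h; apply: noP.
  by exists t => //; exact: h.
have h : (lebesgue_measure (`]t0, (t0 + 1)%R] : set R) <= lebesgue_measure (N : set R))%E.
  by apply: le_measure => //; rewrite ?inE; [exact: measurable_itv|exact: mN].
have E : lebesgue_measure (`]t0, t0 + 1] : set R) = 1%:E.
  by rewrite lebesgue_measure_itv /= lte_fin ltrDl ltr01 -EFinB addrAC subrr add0r.
rewrite E in h; move: N0 h => /= ->; rewrite lee_fin; lra.
Qed.

Theorem mainTheorem17 (R : realType) (H : completeNormedModType R)
    (ipH : inner_product H) (m : nat) (F : 'I_m -> H -> R) (gradF : 'I_m -> H -> H)
    (t0 alpha beta q : R) (x0 v0 : H) (x xd xdd : R -> H) :
  (forall i, convex_fun (F i)) ->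
  (forall i, is_gradient ipH (F i) (gradF i)) ->
  (forall i, lipschitz_map (gradF i)) ->
  0 < t0 -> 0 < alpha -> 0 < beta ->
  assumption_A3 F t0 beta 2 x0 v0 ->
  assumption_A4 F ->
  0 < q < 1 ->
  q * (1 - q) <= beta ->
  MTRIGS_solution ipH gradF t0 alpha beta q 2 x0 v0 x xd xdd ->
  (exists M : R, forall t, t0 <= t -> `|x t| <= M) ->
  forall r : R, q <= r <= (1 + q) / 2 ->
  (\int[lebesgue_measure]_(s in `[t0, +oo[) ((s `^ (2 * r - q)) * `|xd s| ^+ 2)%:E
     < +oo)%E.
Proof.
move=> cvxF gradFP lipF t0_gt0 alpha_gt0 beta_gt0 _ [argminF _] q01 _.
move=> [dx [cxd [acxd [dxd [eqn _]]]]] [M xM] r /andP[_ rq].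
have {}dx t : t0 < t -> is_derive t 1 x (xd t).
  by move=> tt; exact: (deriv_from_is_derive _ _ _ _ _ _ tt (dx t (ltW tt))).
have {}dxd : {ae lebesgue_measure, forall t, t0 < t -> is_derive t 1 xd (xdd t)}.
  apply: (@filterS _ _ (ae_filter_ringOfSetsType (@lebesgue_measure R)) _ _ _ dxd) => t h tt.
  exact: (deriv_from_is_derive _ _ _ _ _ _ tt (h (ltW tt))).
have {}eqn : {ae lebesgue_measure, forall t, t0 < t ->
     (forall i, ip ipH (gradF i (x t) + (beta * t `^ (-2)) *: x t + xdd t) (xd t)
        <= - (alpha * t `^ (- q)) * `|xd t| ^+ 2) /\
     exists l : 'I_m -> R, (forall i, 0 <= l i) /\ \sum_(i < m) l i = 1 /\
       xdd t = - ((alpha * t `^ (- q)) *: xd t) - (beta * t `^ (-2)) *: x t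
               - \sum_(i < m) l i *: gradF i (x t)}.
  apply: (@filterS _ _ (ae_filter_ringOfSetsType (@lebesgue_measure R)) _ _ _ eqn) => t h tt.
  rewrite !powRN; apply: steepest_descent_eq; last by apply: h; exact: ltW.
  by rewrite divr_gt0 ?powR_gt0// (lt_trans t0_gt0).
(* Multipliers summing to one exist at some time, and an empty sum would be zero; hence [m] is
   positive. *)
have [i0 _] : exists i0 : 'I_m, True.
  have [t _ [_ [l [_ [l1 _]]]]] := ae_gt_exists _ _ _ eqn.
  have m0 : (0 < m)%N.
    by case: m l l1 {F gradF cvxF gradFP lipF argminF eqn} => // l; rewrite big_ord0 => /eqP; rewrite eq_sym oner_eq0.
  by exists (Ordinal m0).
have [z hz] := argminF (Winf R H ipH m F t0 beta x xd).
have -> : (\int[lebesgue_measure]_(s in `[t0, +oo[) (s `^ (2 * r - q) * `|xd s| ^+ 2)%:E =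
  \int[lebesgue_measure]_(s in `[t0, +oo[) (kinetic_density R H t0 xd (2 * r - q) s)%:E)%E.
  apply: eq_integral => s; rewrite inE /= in_itv /= andbT => ts.
  by rewrite kinetic_densityE.
have Fz := Sargmin_le_Winf R H ipH m F gradF t0 alpha beta q M x xd xdd
  cvxF gradFP lipF t0_gt0 alpha_gt0 beta_gt0 dx cxd acxd dxd eqn xM i0 z hz.
(* The remaining condition [2 * r - q <= 1] is [r <= (1 + q) / 2]. *)
apply: (integral_kinetic_density R H ipH m F gradF t0 alpha beta q M x xd xdd
  cvxF gradFP lipF t0_gt0 alpha_gt0 beta_gt0 q01 dx cxd acxd dxd eqn xM i0 z Fz).
by lra.
Qed.
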